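(* Let $p$ be a prime and let $\alpha$ be a non-zero algebraic number with $|\alpha|<1$. Let \[ T_p(z)=\prod_{j=1}^{\infty}\left(1-z^{p^{j}}\right)^{-1/p^{j}} . \] Then the value $T_p(\alpha)$ is transcendental over $\overline{\mathbb{Q}}$.
   Context: For $|z|<1$, each factor $(1-z^{p^j})^{-1/p^j}$ is defined using the principal branch (equivalently, $T_p(z)=\exp\bigl(-\sum_{j\ge1}p^{-j}\log(1-z^{p^j})\bigr)$ with the principal logarithm); the product converges absolutely and defines an analytic function on the open unit disk $|z|<1$. *)

(* Defs.v *)
From Stdlib Require Import Reals ZArith Znumtheory List.
From Coquelicot Require Import Coquelicot.
Open Scope R_scope.

(* Principal argument of a complex number, with values in (-PI, PI]
   (atan2 convention; Carg 0 = 0). *)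
Definition Carg (z : C) : R :=
  let x := fst z in let y := snd z in
  if Rlt_dec 0 x then atan (y / x)
  else if Rlt_dec x 0 then
    (if Rle_dec 0 y then atan (y / x) + PI else atan (y / x) - PI)
  else if Rlt_dec 0 y then PI / 2
  else if Rlt_dec y 0 then - (PI / 2)
  else 0.

Definition CLog (z : C) : C := (ln (Cmod z), Carg z).

Definition Cexp (z : C) : C :=
  (exp (fst z) * cos (snd z), exp (fst z) * sin (snd z)).

(* z is algebraic (over Q, equivalently over Qbar): root of a nonzero
   polynomial with integer coefficients, given by its coefficient list. *)
Definition algebraic (z : C) : Prop :=
  exists cs : list Z,
    (exists c, In c cs /\ c <> 0%Z) /\
    fold_right Cplus (RtoC 0)
      (map (fun kc => Cmult (RtoC (IZR (snd kc))) (Cpow z (fst kc)))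
           (combine (seq 0 (length cs)) cs)) = RtoC 0.

Definition transcendental (z : C) : Prop := ~ algebraic z.

(* The j-th term (j >= 1) of  sum_{j>=1} p^{-j} Log(1 - z^{p^j}),
   indexed from 0 (term k corresponds to j = k+1). *)
Definition Tp_log_term (p : nat) (z : C) (k : nat) : C :=
  Cmult (RtoC (/ INR (p ^ (S k))))
        (CLog (Cminus (RtoC 1) (Cpow z (p ^ (S k))))).

(* T_p(z) = exp (- sum_{j>=1} p^{-j} Log(1 - z^{p^j})) is the value
   exp(-S) where S is the sum of that (convergent) series. *)

(* Main.v *)
From mathcomp Require all_boot all_order fingroup perm all_algebra separable cyclotomic.
From mathcomp Require complex ring lra zify boolp reals Rstruct.
Require Import Defs.
From Stdlib Require Import Reals ZArith Znumtheory Lra Lia List.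
From Coquelicot Require Import Coquelicot.
Open Scope R_scope.

(** Iterating T(z^p) = (1 - z^p) T(z)^p expresses T(z^q), q = p^k, through z and T(z); if alpha and
    T(alpha) are both algebraic, the logarithmic height of T(alpha^q) is therefore O(k q), a factor k
    too large for Mahler's original argument.  The remedy is to let k depend on the auxiliary
    polynomial.  Fix the degree N in y; for every M, Siegel's lemma gives an integer polynomial P(z, y)
    of degree at most M in z such that P(z, T(z)) vanishes at 0 to some order n >= M N.  The order is
    finite because T is a transcendental function: T grows without bound on the radius to any p-power
    root of unity, so the top coefficient in y of an algebraic relation would vanish at all of them.
    All constants depending on P are at most exp(O(n^4)), hence already negligible against
    exp(O(q)) for k a small multiple of n.  Then P(alpha^q, T(alpha^q)) is non-zero and about
    |alpha|^(n q), whereas Liouville's inequality bounds it below by exp(-O((M + N k) q)).  Hence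
    n = O(M + N k), which is impossible for N large, M much larger, M N <= n and k << n / N.
    Choosing k after n makes any zero estimate unnecessary. *)

(** * Power series of the logarithm and of the exponential *)

(** The functional equation has degree p in T(z), the same as the degree of z -> z^p: this is the
    borderline that Mahler's original argument excludes. Each of the k iterations adds a factor (1 -
    alpha^(p^j))^(p^(k-j)), of logarithmic height O(q), whence the factor k.

    The cost of P is explained by denominators: the coefficients of T_p up to order m have a common
    denominator exp(O(m^3)), and Siegel's lemma with M N <= n equations raises it to the power M N.
    As q is exponential in k, a small multiple of n is enough for k.

    Neither number fields nor holomorphic functions are needed. Algebraic numbers act as rational
    matrices with a common eigenvector [w], and heights become row sums of integer matrices. Since
    T_p has non-negative coefficients, Cauchy estimates and comparisons with T_p at real radii are
    proved for the polynomials [truncT p m], with bounds independent of m, and pass to the limit.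
    The principal logarithm enters only through its Taylor bound and through [Cexp (CLog w) = w]. *)

Definition cder (f : R -> C) (t : R) (d : C) :=
  is_derive (fun s => fst (f s)) t (fst d) /\ is_derive (fun s => snd (f s)) t (snd d).

Lemma cder_eq f t d d' : cder f t d -> d = d' -> cder f t d'.
Proof. intros H <-; exact H. Qed.

Lemma cder_ext f g t d : (forall s, f s = g s) -> cder f t d -> cder g t d.
Proof.
intros E [H1 H2]; split; [apply is_derive_ext with (2 := H1) | apply is_derive_ext with (2 := H2)];
  intros s; now rewrite E.
Qed.

Lemma cder_const c t : cder (fun _ => c) t (RtoC 0).
Proof. split; exact (is_derive_const _ _). Qed.

Lemma cder_ray z t : cder (fun s => Cmult (RtoC s) z) t z.
Proof. split; simpl; auto_derive; auto; ring. Qed.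

Lemma cder_plus f g t df dg :
  cder f t df -> cder g t dg -> cder (fun s => Cplus (f s) (g s)) t (Cplus df dg).
Proof.
intros [F1 F2] [G1 G2]; split; simpl.
- exact (is_derive_plus _ _ _ _ _ F1 G1).
- exact (is_derive_plus _ _ _ _ _ F2 G2).
Qed.

Lemma is_derive_Rmult (f g : R -> R) t df dg : is_derive f t df -> is_derive g t dg ->
  is_derive (fun s => f s * g s) t (df * g t + f t * dg).
Proof.
intros F G; apply (is_derive_mult f g t df dg F G); intros; apply Rmult_comm.
Qed.

Lemma cder_mult f g t df dg : cder f t df -> cder g t dg ->
  cder (fun s => Cmult (f s) (g s)) t (Cplus (Cmult df (g t)) (Cmult (f t) dg)).
Proof.
intros [F1 F2] [G1 G2]; split; simpl.
- replace (_ + _) with (minus (fst df * fst (g t) + fst (f t) * fst dg)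
    (snd df * snd (g t) + snd (f t) * snd dg)) by (unfold minus, plus, opp; simpl; ring).
  exact (is_derive_minus _ _ _ _ _ (is_derive_Rmult _ _ _ _ _ F1 G1) (is_derive_Rmult _ _ _ _ _ F2 G2)).
- replace (_ + _) with (plus (fst df * snd (g t) + fst (f t) * snd dg)
    (snd df * fst (g t) + snd (f t) * fst dg)) by (unfold plus; simpl; ring).
  exact (is_derive_plus _ _ _ _ _ (is_derive_Rmult _ _ _ _ _ F1 G2) (is_derive_Rmult _ _ _ _ _ F2 G1)).
Qed.

Lemma cder_pow z n t :
  cder (fun s => Cpow (Cmult (RtoC s) z) (S n)) t
    (Cmult (RtoC (INR (S n))) (Cmult z (Cpow (Cmult (RtoC t) z) n))).
Proof.
induction n as [|n IH].
- apply cder_ext with (fun s => Cmult (RtoC s) z); [intros s; simpl; ring|].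
  apply cder_eq with z; [apply cder_ray | simpl; ring].
- apply cder_ext with (fun s => Cmult (Cmult (RtoC s) z) (Cpow (Cmult (RtoC s) z) (S n)));
    [intros s; now rewrite <- Cpow_S|].
  eapply cder_eq; [apply (cder_mult _ _ _ _ _ (cder_ray z t) IH)|].
  rewrite (S_INR (S n)), RtoC_plus, Cpow_S; ring.
Qed.

Lemma Cmod_le_abs z : Cmod z <= Rabs (fst z) + Rabs (snd z).
Proof.
assert (E : z = Cplus (RtoC (fst z)) (Cmult (RtoC (snd z)) Ci)).
{ destruct z; apply injective_projections; simpl; ring. }
rewrite E at 1; eapply Rle_trans; [apply Cmod_triangle|].
rewrite Cmod_mult, Cmod_Ci, !Cmod_R; lra.
Qed.

(** A complex-valued function has no mean value equality; the factor 2 is the price of applying the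
    real one to each component. *)
Lemma cder_bound f df K :
  (forall t, 0 <= t <= 1 -> cder f t (df t)) ->
  (forall t, 0 <= t <= 1 -> Cmod (df t) <= K) ->
  Cmod (Cminus (f 1) (f 0)) <= 2 * K.
Proof.
intros D B.
assert (real_bound : forall g dg : R -> R, (forall t, 0 <= t <= 1 -> is_derive g t (dg t)) ->
  (forall t, 0 <= t <= 1 -> Rabs (dg t) <= K) -> Rabs (g 1 - g 0) <= K).
{ intros g dg Hd Hb.
  destruct (MVT_gen g 0 1 dg) as [c [Hc E]].
  - intros t Ht; rewrite Rmin_left, Rmax_right in Ht by lra; apply Hd; lra.
  - intros t Ht; rewrite Rmin_left, Rmax_right in Ht by lra.
    apply continuity_pt_filterlim, (ex_derive_continuous g); exists (dg t); now apply Hd.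
  - rewrite Rmin_left, Rmax_right in Hc by lra; rewrite E.
    replace (dg c * (1 - 0)) with (dg c) by ring; now apply Hb. }
eapply Rle_trans; [apply Cmod_le_abs|].
assert (H1 := real_bound (fun s => fst (f s)) (fun s => fst (df s))
  (fun t Ht => proj1 (D t Ht))).
assert (H2 := real_bound (fun s => snd (f s)) (fun s => snd (df s))
  (fun t Ht => proj2 (D t Ht))).
assert (M : forall z, Rabs (fst z) <= Cmod z /\ Rabs (snd z) <= Cmod z).
{ intros z; assert (H := Rmax_Cmod z); split; eapply Rle_trans; try apply H;
    [apply Rmax_l | apply Rmax_r]. }
simpl.
assert (Rabs (fst (f 1) - fst (f 0)) <= K).
{ apply H1; intros t Ht; eapply Rle_trans; [apply M | now apply B]. }
assert (Rabs (snd (f 1) - snd (f 0)) <= K).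
{ apply H2; intros t Ht; eapply Rle_trans; [apply M | now apply B]. }
unfold Rminus in *; lra.
Qed.

Fixpoint csum (f : nat -> C) (n : nat) : C :=
  match n with O => RtoC 0 | S m => Cplus (csum f m) (f m) end.

Lemma csum_S f n : csum f (S n) = Cplus (csum f n) (f n).
Proof. easy. Qed.

Lemma csum_plus f g n :
  csum (fun i => Cplus (f i) (g i)) n = Cplus (csum f n) (csum g n).
Proof. induction n as [|n IH]; [unfold csum; ring|]; rewrite !csum_S, IH; ring. Qed.

Lemma cder_csum (f : nat -> R -> C) df t n : (forall i, cder (f i) t (df i)) ->
  cder (fun s => csum (fun i => f i s) n) t (csum df n).
Proof.
intros H; induction n as [|n IH]; simpl; [apply cder_const | now apply cder_plus].
Qed.

Lemma Cexp_plus a b : Cexp (Cplus a b) = Cmult (Cexp a) (Cexp b).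
Proof.
unfold Cexp; apply injective_projections; simpl; rewrite exp_plus, ?cos_plus, ?sin_plus; ring.
Qed.

Lemma Cexp_0 : Cexp (RtoC 0) = RtoC 1.
Proof.
unfold Cexp; simpl; rewrite exp_0, cos_0, sin_0; apply injective_projections; simpl; ring.
Qed.

Lemma Cmod_Cexp w : Cmod (Cexp w) = exp (fst w).
Proof.
unfold Cmod, Cexp; simpl.
replace (_ + _) with (Rsqr (exp (fst w))).
- apply sqrt_Rsqr, Rlt_le, exp_pos.
- assert (H := sin2_cos2 (snd w)); unfold Rsqr in *.
  transitivity (exp (fst w) * exp (fst w) *
    (sin (snd w) * sin (snd w) + cos (snd w) * cos (snd w)));
    [rewrite H; ring | ring].
Qed.

(** The right half-plane suffices because [1 - z ^ p] lies in it for |z| < 1; there [Carg] is a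
    single arctangent. *)
Lemma Cexp_CLog w : 0 < fst w -> Cexp (CLog w) = w.
Proof.
intros H; destruct w as [x y]; simpl in H.
assert (Hm : 0 < Cmod (x, y)).
{ apply Cmod_gt_0; intros E; injection E; lra. }
unfold Cexp, CLog, Carg; simpl; destruct (Rlt_dec 0 x) as [_|]; [|lra].
rewrite exp_ln by easy; rewrite cos_atan, sin_atan.
assert (E : Cmod (x, y) = x * sqrt (1 + Rsqr (y / x))).
{ unfold Cmod; simpl; rewrite <- (sqrt_Rsqr x) at 3 by lra.
  rewrite <- sqrt_mult_alt by apply Rle_0_sqr; f_equal; unfold Rsqr; field; lra. }
assert (0 < sqrt (1 + Rsqr (y / x))).
{ apply sqrt_lt_R0; assert (H1 := Rle_0_sqr (y / x)); lra. }
rewrite E; apply injective_projections; simpl; field; repeat split; lra.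
Qed.

Lemma cder_Cexp_ray w t :
  cder (fun s => Cexp (Cmult (RtoC s) w)) t (Cmult w (Cexp (Cmult (RtoC t) w))).
Proof.
destruct w as [u v].
assert (E : forall s, Cexp (Cmult (RtoC s) (u, v)) =
  (exp (s * u) * cos (s * v), exp (s * u) * sin (s * v))).
{ intros s; unfold Cexp; simpl.
  replace (s * u - 0 * v) with (s * u) by ring.
  now replace (s * v + 0 * u) with (s * v) by ring. }
rewrite E; apply (cder_ext _ _ _ _ (fun s => eq_sym (E s))).
split; simpl; auto_derive; auto; ring.
Qed.

Lemma cder_CLog_ray z t : 0 <= t <= 1 -> Cmod z < 1 ->
  cder (fun s => CLog (Cminus (RtoC 1) (Cmult (RtoC s) z))) t
    (Copp (Cdiv z (Cminus (RtoC 1) (Cmult (RtoC t) z)))).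
Proof.
intros Ht Hz; destruct z as [x y].
assert (pos : forall s, 0 <= s <= 1 -> 0 < 1 - s * x).
{ intros s Hs; assert (H := Rmax_Cmod (x, y)); simpl in H.
  assert (Rabs x < 1) by (eapply Rle_lt_trans; [eapply Rle_trans; [apply Rmax_l|apply H]|exact Hz]).
  apply Rabs_def2 in H0; nra. }
specialize (pos t Ht).
(* Near [t] the real part stays positive, which settles the case distinction of [Carg], and the
   logarithm of the square root is half a logarithm: [f] is the resulting differentiable formula. *)
pose (f := fun s => (/ 2 * ln ((1 - s * x) ^ 2 + (s * y) ^ 2), atan (- (s * y) / (1 - s * x)))).
assert (near : locally t (fun s => CLog (Cminus (RtoC 1) (Cmult (RtoC s) (x, y))) = f s)).
{ assert (L : locally t (fun s => 0 < 1 - s * x)).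
  { apply (open_comp (fun s => 1 - s * x) (fun u => 0 < u)); [|apply open_gt|exact pos].
    intros s _; apply (ex_derive_continuous (fun s => 1 - s * x)); auto_derive; auto. }
  revert L; apply filter_imp; intros s Hs; unfold CLog, Carg, f, Cmod.
  replace (Cminus (RtoC 1) (Cmult (RtoC s) (x, y))) with ((1 - s * x, - (s * y)) : C)
    by (apply injective_projections; simpl; ring).
  cbv [fst snd]; replace ((- (s * y)) ^ 2) with ((s * y) ^ 2) by ring.
  destruct (Rlt_dec 0 (1 - s * x)) as [_|N]; [|contradiction].
  f_equal; assert (q : 0 < (1 - s * x) ^ 2 + (s * y) ^ 2) by nra.
  rewrite <- (sqrt_sqrt ((1 - s * x) ^ 2 + (s * y) ^ 2)) at 2 by lra.
  rewrite ln_mult by now apply sqrt_lt_R0. field. }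
assert (sq : 0 < (1 - t * x) ^ 2 + (t * y) ^ 2) by nra.
assert (D : cder f t (Copp (Cdiv (x, y) (Cminus (RtoC 1) (Cmult (RtoC t) (x, y)))))).
{ split; simpl; auto_derive; repeat split; try lra.
  - field; repeat split; nra.
  - field; repeat split; nra. }
destruct D as [D1 D2]; split.
- apply is_derive_ext_loc with (2 := D1); revert near; apply filter_imp; intros s ->; easy.
- apply is_derive_ext_loc with (2 := D2); revert near; apply filter_imp; intros s ->; easy.
Qed.

(** Taylor polynomial of -Log(1 - z), hence the plus signs in the error bounds below. *)
Definition log_sum (z : C) (n : nat) : C :=
  csum (fun i => Cmult (RtoC (/ INR (S i))) (Cpow z (S i))) n.

Definition exp_sum (w : C) (n : nat) : C :=
  csum (fun k => Cmult (RtoC (/ INR (fact k))) (Cpow w k)) n.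

Lemma geometric_csum z n : Cmult (Cminus (RtoC 1) z) (csum (Cpow z) n) = Cminus (RtoC 1) (Cpow z n).
Proof.
induction n as [|n IH]; simpl; [ring|].
rewrite Cmult_plus_distr_l, IH; ring.
Qed.

Lemma cder_scal c f t d : cder f t d -> cder (fun s => Cmult c (f s)) t (Cmult c d).
Proof.
intros H; eapply cder_eq; [apply (cder_mult _ _ _ _ _ (cder_const c t) H) | ring].
Qed.

Lemma RtoC_INR_neq0 n : RtoC (INR (S n)) <> RtoC 0.
Proof. intros E; apply (not_0_INR (S n)); [easy | now injection E]. Qed.

Lemma Cmod_ray z t : 0 <= t <= 1 -> Cmod (Cmult (RtoC t) z) <= Cmod z.
Proof.
intros Ht; rewrite Cmod_mult, Cmod_R, Rabs_pos_eq by lra.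
assert (H := Cmod_ge_0 z); nra.
Qed.

(** Along the ray s z the derivative of Log(1 - s z) plus its Taylor sum collapses, by the geometric
    series, to -z (s z)^n / (1 - s z). *)
Lemma CLog_taylor z n : Cmod z < 1 ->
  Cmod (Cplus (CLog (Cminus (RtoC 1) z)) (log_sum z n)) <= 2 * (Cmod z ^ S n / (1 - Cmod z)).
Proof.
intros Hz; assert (Hz0 := Cmod_ge_0 z).
pose (f := fun s => Cplus (CLog (Cminus (RtoC 1) (Cmult (RtoC s) z)))
  (log_sum (Cmult (RtoC s) z) n)).
assert (nz : forall t, 0 <= t <= 1 -> 1 - Cmod z <= Cmod (Cminus (RtoC 1) (Cmult (RtoC t) z))).
{ intros t Ht; assert (H := Cmod_ray z t Ht).
  assert (T := Cmod_triangle (Cminus (RtoC 1) (Cmult (RtoC t) z)) (Cmult (RtoC t) z)).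
  replace (Cplus _ _) with (RtoC 1) in T by ring; rewrite Cmod_1 in T; lra. }
assert (E : Cplus (CLog (Cminus (RtoC 1) z)) (log_sum z n) = Cminus (f 1) (f 0)).
{ unfold f; replace (Cmult (RtoC 1) z) with z by ring.
  replace (Cmult (RtoC 0) z) with (RtoC 0) by ring.
  replace (CLog (Cminus (RtoC 1) (RtoC 0))) with (RtoC 0);
    [replace (log_sum (RtoC 0) n) with (RtoC 0); [ring|]|].
  - unfold log_sum; clear; induction n as [|n IH]; [easy|]; rewrite csum_S, <- IH, Cpow_S; ring.
  - replace (Cminus (RtoC 1) (RtoC 0)) with (RtoC 1) by ring.
    unfold CLog, Carg; rewrite Cmod_1, ln_1; simpl; destruct (Rlt_dec 0 1) as [_|]; [|lra].
    replace (0 / 1) with 0 by field; now rewrite atan_0. }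
rewrite E; eapply (cder_bound f (fun t => Copp (Cmult z (Cdiv (Cpow (Cmult (RtoC t) z) n)
  (Cminus (RtoC 1) (Cmult (RtoC t) z)))))).
- intros t Ht; eapply cder_eq.
  + apply cder_plus; [now apply cder_CLog_ray|].
    apply (cder_csum (fun i s => Cmult (RtoC (/ INR (S i))) (Cpow (Cmult (RtoC s) z) (S i)))
      (fun i => Cmult z (Cpow (Cmult (RtoC t) z) i))).
    intros i; eapply cder_eq; [apply cder_scal, cder_pow|].
    rewrite RtoC_inv by now apply not_0_INR.
    field; apply RtoC_INR_neq0.
  + assert (N : Cminus (RtoC 1) (Cmult (RtoC t) z) <> RtoC 0).
    { apply Cmod_gt_0; specialize (nz t Ht); lra. }
    assert (G := geometric_csum (Cmult (RtoC t) z) n).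
    replace (csum _ n) with (Cmult z (csum (Cpow (Cmult (RtoC t) z)) n)).
    * replace (csum (Cpow (Cmult (RtoC t) z)) n) with
        (Cdiv (Cminus (RtoC 1) (Cpow (Cmult (RtoC t) z) n)) (Cminus (RtoC 1) (Cmult (RtoC t) z))).
      { field; exact N. }
      rewrite <- G; field; exact N.
    * clear; induction n as [|n IH]; [simpl; ring|]; rewrite !csum_S, <- IH; ring.
- intros t Ht; specialize (nz t Ht).
  rewrite Cmod_opp, Cmod_mult, Cmod_div by (apply Cmod_gt_0; lra).
  rewrite Cmod_pow; simpl pow; unfold Rdiv; rewrite Rmult_assoc.
  apply Rmult_le_compat_l; [easy|]; apply Rmult_le_compat.
  + apply pow_le, Cmod_ge_0.
  + apply Rlt_le, Rinv_0_lt_compat; lra.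
  + apply pow_incr; split; [apply Cmod_ge_0 | now apply Cmod_ray].
  + apply Rinv_le_contravar; lra.
Qed.

Lemma cder_exp_sum w m t :
  cder (fun s => exp_sum (Cmult (RtoC s) w) (S m)) t (Cmult w (exp_sum (Cmult (RtoC t) w) m)).
Proof.
induction m as [|m IH].
- apply cder_eq with (RtoC 0); [|unfold exp_sum, csum; ring].
  apply cder_ext with (fun _ => RtoC 1); [|apply cder_const].
  intros s; unfold exp_sum; simpl; rewrite Rinv_1; ring.
- eapply cder_eq.
  + apply (cder_plus (fun s => exp_sum (Cmult (RtoC s) w) (S m)) (fun s =>
      Cmult (RtoC (/ INR (fact (S m)))) (Cpow (Cmult (RtoC s) w) (S m)))); [exact IH|].
    apply cder_scal, cder_pow.
  + unfold exp_sum; rewrite csum_S.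
    rewrite fact_simpl, mult_INR, Rinv_mult, RtoC_mult.
    rewrite !RtoC_inv by (apply INR_fact_neq_0 || now apply not_0_INR).
    assert (H1 := RtoC_INR_neq0 m).
    assert (H2 : RtoC (INR (fact m)) <> RtoC 0) by (intros E; injection E; apply INR_fact_neq_0).
    field; auto.
Qed.

(** Differentiate [Cexp (- s w) * exp_sum (s w) (m + 1)] in [s]: all terms cancel but the last. *)
Lemma Cexp_taylor w m :
  Cmod (Cminus (exp_sum w (S m)) (Cexp w)) <=
  2 * (exp (2 * Cmod w) * (Cmod w ^ S m / INR (fact m))).
Proof.
pose (f := fun s => Cmult (Cexp (Cmult (RtoC s) (Copp w))) (exp_sum (Cmult (RtoC s) w) (S m))).
assert (Hw := Cmod_ge_0 w).
assert (re : forall u, exp (fst u) <= exp (Cmod u)).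
{ intros u; assert (H := re_le_Cmod u); assert (H1 := Rle_abs (Re u)); unfold Re in *.
  destruct (Rle_lt_or_eq_dec (fst u) (Cmod u)) as [L|L]; [lra | now apply Rlt_le, exp_increasing|rewrite L; lra]. }
assert (F0 : INR (fact m) > 0) by apply INR_fact_lt_0.
assert (B : Cmod (Cminus (f 1) (f 0)) <= 2 * (exp (Cmod w) * (Cmod w ^ S m / INR (fact m)))).
{ apply (cder_bound f (fun t => Copp (Cmult (Cexp (Cmult (RtoC t) (Copp w)))
    (Cmult w (Cmult (RtoC (/ INR (fact m))) (Cpow (Cmult (RtoC t) w) m)))))).
  - intros t Ht; eapply cder_eq.
    + apply (cder_mult _ _ _ _ _ (cder_Cexp_ray (Copp w) t) (cder_exp_sum w m t)).
    + unfold exp_sum; rewrite csum_S; ring.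
  - intros t Ht; rewrite Cmod_opp, !Cmod_mult, Cmod_pow, Cmod_Cexp.
    apply Rmult_le_compat; [apply Rlt_le, exp_pos| | |].
    + apply Rmult_le_pos; [easy|apply Rmult_le_pos; [apply Cmod_ge_0|apply pow_le, Cmod_ge_0]].
    + eapply Rle_trans; [apply re|].
      assert (H := Cmod_ray (Copp w) t Ht); rewrite Cmod_opp in H.
      destruct H as [H|H]; [now apply Rlt_le, exp_increasing | rewrite H; lra].
    + rewrite Cmod_R, Rabs_pos_eq by (apply Rlt_le, Rinv_0_lt_compat; lra).
      simpl pow; unfold Rdiv; rewrite Rmult_assoc; apply Rmult_le_compat_l; [easy|].
      rewrite Rmult_comm; apply Rmult_le_compat_r; [apply Rlt_le, Rinv_0_lt_compat; lra|].
      apply pow_incr; split; [apply Cmod_ge_0 | now apply Cmod_ray]. }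
assert (E : Cminus (exp_sum w (S m)) (Cexp w) = Cmult (Cexp w) (Cminus (f 1) (f 0))).
{ unfold f; replace (Cmult (RtoC 1) (Copp w)) with (Copp w) by ring.
  replace (Cmult (RtoC 1) w) with w by ring; replace (Cmult (RtoC 0) w) with (RtoC 0) by ring.
  replace (Cmult (RtoC 0) (Copp w)) with (RtoC 0) by ring; rewrite Cexp_0.
  replace (exp_sum (RtoC 0) (S m)) with (RtoC 1).
  - assert (X : Cmult (Cexp w) (Cexp (Copp w)) = RtoC 1).
    { rewrite <- Cexp_plus, <- Cexp_0; f_equal; ring. }
    transitivity (Cminus (Cmult (Cmult (Cexp w) (Cexp (Copp w))) (exp_sum w (S m))) (Cexp w));
      [rewrite X; ring | ring].
  - unfold exp_sum; clear; induction m as [|m IH]; [simpl; rewrite Rinv_1; ring|].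
    rewrite csum_S, <- IH, Cpow_S; ring. }
rewrite E, Cmod_mult, Cmod_Cexp.
replace (2 * Cmod w) with (Cmod w + Cmod w) by ring; rewrite exp_plus.
assert (P := exp_pos (fst w)); assert (M0 := Cmod_ge_0 (Cminus (f 1) (f 0))).
apply Rle_trans with (exp (Cmod w) * (2 * (exp (Cmod w) * (Cmod w ^ S m / INR (fact m))))); [|lra].
apply Rmult_le_compat; [lra | easy | apply re | exact B].
Qed.

Lemma Cmod_csum_geometric f K n : 0 <= K ->
  (forall i, Cmod (f i) <= K * (/ 2) ^ S i) -> Cmod (csum f n) <= K.
Proof.
intros HK H; assert (G : Cmod (csum f n) <= K * (1 - (/ 2) ^ n)).
{ induction n as [|n IH]; [simpl; rewrite Cmod_0; lra|].
  simpl csum; eapply Rle_trans; [apply Cmod_triangle|]; specialize (H n); simpl pow in *; lra. }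
assert (0 <= (/ 2) ^ n) by (apply pow_le; lra); nra.
Qed.

(** * The logarithm of T_p *)

Section LogSeries.
Variable p : nat.
Hypothesis p_ge2 : (2 <= p)%nat.

Lemma INR_pow_pos j : 0 < INR (p ^ j).
Proof. apply lt_0_INR, Nat.neq_0_lt_0, Nat.pow_nonzero; lia. Qed.

Lemma Rinv_pow_le j : / INR (p ^ j) <= (/ 2) ^ j.
Proof.
rewrite pow_inv; apply Rinv_le_contravar; [apply pow_lt; lra|].
replace 2 with (INR 2) by (simpl; ring); rewrite <- pow_INR; apply le_INR.
now apply Nat.pow_le_mono_l.
Qed.

Lemma pow_le_self x n : 0 <= x <= 1 -> (1 <= n)%nat -> x ^ n <= x.
Proof.
intros Hx Hn; destruct n as [|n]; [lia|]; simpl.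
assert (x ^ n <= 1) by (rewrite <- (pow1 n); apply pow_incr; lra); nra.
Qed.

Lemma Cmod_pow_p z j : Cmod z < 1 -> Cmod (Cpow z (p ^ j)) <= Cmod z.
Proof.
intros Hz; rewrite Cmod_pow; apply pow_le_self.
- split; [apply Cmod_ge_0 | lra].
- assert (p ^ j <> 0)%nat by (apply Nat.pow_nonzero; lia); lia.
Qed.

(** Approximates log T_p, that is minus the sum of [Tp_log_term]. Cutting both the product and each
    logarithm at [m] makes it the value at [z] of a rational polynomial, [logT p m] below. *)
Definition log_trunc (z : C) (m : nat) : C :=
  csum (fun j => Cmult (RtoC (/ INR (p ^ S j))) (log_sum (Cpow z (p ^ S j)) m)) m.

Lemma taylor_remainder_mono z u n : Cmod u <= Cmod z < 1 ->
  Cmod u ^ S n / (1 - Cmod u) <= Cmod z ^ S n / (1 - Cmod z).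
Proof.
intros H; assert (Hu := Cmod_ge_0 u); apply Rmult_le_compat.
- apply pow_le; lra.
- apply Rlt_le, Rinv_0_lt_compat; lra.
- apply pow_incr; lra.
- apply Rinv_le_contravar; lra.
Qed.

Lemma Tp_log_term_taylor z n j : Cmod z < 1 ->
  Cmod (Cplus (Tp_log_term p z j)
    (Cmult (RtoC (/ INR (p ^ S j))) (log_sum (Cpow z (p ^ S j)) n))) <=
  2 * (Cmod z ^ S n / (1 - Cmod z)) * (/ 2) ^ S j.
Proof.
intros Hz; unfold Tp_log_term.
assert (Hu := Cmod_pow_p z (S j) Hz); set (u := Cpow z (p ^ S j)) in *.
rewrite <- Cmult_plus_distr_l, Cmod_mult, Cmod_R, Rabs_pos_eq
  by (apply Rlt_le, Rinv_0_lt_compat, INR_pow_pos).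
rewrite Rmult_comm; apply Rmult_le_compat.
- apply Cmod_ge_0.
- apply Rlt_le, Rinv_0_lt_compat, INR_pow_pos.
- eapply Rle_trans; [apply CLog_taylor; lra|].
  apply Rmult_le_compat_l; [lra|]; apply taylor_remainder_mono; lra.
- apply Rinv_pow_le.
Qed.

Lemma Tp_log_term_bound z j : Cmod z < 1 ->
  Cmod (Tp_log_term p z j) <= 2 * (Cmod z / (1 - Cmod z)) * (/ 2) ^ S j.
Proof.
intros Hz; assert (H := Tp_log_term_taylor z 0 j Hz); unfold log_sum in H; simpl csum in H.
rewrite Cmult_0_r, Cplus_0_r, pow_1 in H; exact H.
Qed.

Lemma Tp_log_term_summable z : Cmod z < 1 ->
  exists S, @is_series C_AbsRing C_NormedModule (Tp_log_term p z) S.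
Proof.
intros Hz; apply (@ex_series_le C_AbsRing C_CompleteNormedModule (Tp_log_term p z)
  (fun j => 2 * (Cmod z / (1 - Cmod z)) * (/ 2) ^ S j)).
- intros j; exact (Tp_log_term_bound z j Hz).
- apply (ex_series_ext (fun j => (2 * (Cmod z / (1 - Cmod z)) * / 2) * (/ 2) ^ j)).
  { intros j; simpl; ring. }
  assert (G : ex_series (fun j => (/ 2) ^ j)) by (apply ex_series_geom; rewrite Rabs_pos_eq; lra).
  exact (ex_series_scal (V := R_NormedModule) (2 * (Cmod z / (1 - Cmod z)) * / 2) _ G).
Qed.

Lemma log_trunc_error z m : Cmod z < 1 ->
  Cmod (Cplus (log_trunc z m) (csum (Tp_log_term p z) m)) <= 2 * (Cmod z ^ S m / (1 - Cmod z)).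
Proof.
intros Hz; assert (Hz0 := Cmod_ge_0 z).
replace (Cplus _ _) with (csum (fun j => Cplus (Tp_log_term p z j)
    (Cmult (RtoC (/ INR (p ^ S j))) (log_sum (Cpow z (p ^ S j)) m))) m).
- apply Cmod_csum_geometric.
  + apply Rmult_le_pos; [lra|]; apply Rmult_le_pos; [apply pow_le; lra|].
    apply Rlt_le, Rinv_0_lt_compat; lra.
  + intros j; now apply Tp_log_term_taylor.
- rewrite csum_plus; apply Cplus_comm.
Qed.

Lemma csum_sum_n f n : csum f (S n) = @sum_n C_AbelianMonoid f n.
Proof.
induction n as [|n IH]; [rewrite sum_O; simpl; ring|].
rewrite sum_Sn, <- IH; easy.
Qed.

Lemma is_series_csum f l : @is_series C_AbsRing C_NormedModule f l ->
  forall eps, 0 < eps -> exists m0, forall m, (m0 <= m)%nat -> Cmod (Cminus (csum f m) l) < eps.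
Proof.
intros H eps He.
assert (L := proj1 (filterlim_locally_ball_norm _ _) H (mkposreal eps He)).
destruct L as [N HN]; exists (S N); intros m Hm; destruct m as [|m]; [lia|].
rewrite csum_sum_n; apply (HN m); lia.
Qed.

Lemma is_series_C_unique f l1 l2 : @is_series C_AbsRing C_NormedModule f l1 ->
  @is_series C_AbsRing C_NormedModule f l2 -> l1 = l2.
Proof.
intros H1 H2; apply (filterlim_locally_unique (F := eventually) _ l1 l2 H1 H2).
Qed.

Lemma Cexp_INR_mult n w : Cpow (Cexp w) n = Cexp (Cmult (RtoC (INR n)) w).
Proof.
induction n as [|n IH]; [simpl INR; rewrite Cmult_0_l, Cexp_0; easy|].
rewrite Cpow_S, IH, <- Cexp_plus, S_INR, RtoC_plus; f_equal; ring.
Qed.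

Lemma Cexp_lipschitz d : Cmod (Cminus (Cexp d) (RtoC 1)) <= 2 * (exp (2 * Cmod d) * Cmod d).
Proof.
assert (H := Cexp_taylor d 0); unfold exp_sum in H; simpl csum in H; simpl fact in H.
rewrite <- Cmod_opp.
replace (Copp (Cminus (Cexp d) (RtoC 1))) with
  (Cminus (Cplus (RtoC 0) (Cmult (RtoC (/ INR 1)) (RtoC 1))) (Cexp d)).
- eapply Rle_trans; [exact H|]; right; simpl; field.
- simpl INR; rewrite Rinv_1; ring.
Qed.

(** Product, logarithms and exponential are all truncated at the same [m], so T_p becomes a limit of
    rational polynomials. The error splits in two: the exponential remainder at the bounded point
    [log_trunc z m], beaten by the factorial, and Cexp(-S) (Cexp(d) - 1) with d = [log_trunc z m] +
    S tending to 0. *)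
Lemma exp_log_trunc_cvg z S : Cmod z < 1 ->
  @is_series C_AbsRing C_NormedModule (Tp_log_term p z) S ->
  forall eps, 0 < eps -> exists m0, forall m, (m0 <= m)%nat ->
    Cmod (Cminus (exp_sum (log_trunc z m) (Datatypes.S m)) (Cexp (Copp S))) < eps.
Proof.
intros Hz HS eps Heps; assert (Hz0 := Cmod_ge_0 z).
set (K := 2 / (1 - Cmod z)).
assert (K0 : 0 < K) by (apply Rmult_lt_0_compat; [lra | apply Rinv_0_lt_compat; lra]).
assert (err : forall m, Cmod (Cplus (log_trunc z m) (csum (Tp_log_term p z) m)) <= K * Cmod z ^ m).
{ intros m; eapply Rle_trans; [now apply log_trunc_error|].
  unfold K; replace (2 * (Cmod z ^ Datatypes.S m / (1 - Cmod z))) with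
    (2 / (1 - Cmod z) * Cmod z ^ Datatypes.S m) by (field; lra).
  apply Rmult_le_compat_l; [unfold K in K0; lra|]; simpl.
  assert (0 <= Cmod z ^ m) by (apply pow_le; lra); nra. }
assert (bnd : forall m, Cmod (log_trunc z m) <= 2 * K).
{ intros m.
  assert (A : Cmod (csum (Tp_log_term p z) m) <= K).
  { apply Cmod_csum_geometric; [lra|]; intros i; eapply Rle_trans; [now apply Tp_log_term_bound|].
    apply Rmult_le_compat_r; [apply pow_le; lra|]; unfold K.
    replace (2 * (Cmod z / (1 - Cmod z))) with (2 / (1 - Cmod z) * Cmod z) by (field; lra).
    unfold K in K0; nra. }
  assert (B : K * Cmod z ^ m <= K).
  { assert (Cmod z ^ m <= 1) by (rewrite <- (pow1 m); apply pow_incr; lra); nra. }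
  replace (log_trunc z m) with (Cminus (Cplus (log_trunc z m) (csum (Tp_log_term p z) m))
    (csum (Tp_log_term p z) m)) by ring.
  eapply Rle_trans; [apply Cmod_triangle|]; rewrite Cmod_opp; specialize (err m); lra. }
set (d := fun m => Cplus (log_trunc z m) S).
assert (dlim : forall e, 0 < e -> exists m0, forall m, (m0 <= m)%nat -> Cmod (d m) < e).
{ intros e He.
  destruct (is_series_csum _ _ HS (e / 2)) as [m1 H1]; [lra|].
  destruct (pow_lt_1_zero (Cmod z) ltac:(rewrite Rabs_pos_eq; lra) (e / 2 / K)) as [m2 H2].
  { apply Rdiv_lt_0_compat; lra. }
  exists (m1 + m2)%nat; intros m Hm; unfold d.
  replace (Cplus (log_trunc z m) S) with
    (Cminus (Cplus (log_trunc z m) (csum (Tp_log_term p z) m)) (Cminus (csum (Tp_log_term p z) m) S)) by ring.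
  eapply Rle_lt_trans; [apply Cmod_triangle|]; rewrite Cmod_opp.
  specialize (H1 m ltac:(lia)); specialize (H2 m ltac:(lia)); specialize (err m).
  rewrite Rabs_pos_eq in H2 by (apply pow_le; lra).
  apply (Rmult_lt_compat_l K) in H2; [|exact K0].
  replace (K * (e / 2 / K)) with (e / 2) in H2 by (field; lra); lra. }
set (A := 2 * exp (2 * (2 * K)) * (2 * K)).
assert (A0 : 0 < A).
{ unfold A; assert (P := exp_pos (2 * (2 * K))); apply Rmult_lt_0_compat; lra. }
destruct (cv_speed_pow_fact (2 * K) (eps / 2 / A)) as [m1 H1].
{ apply Rdiv_lt_0_compat; lra. }
set (B := 2 * exp 2 * Cmod (Cexp (Copp S))).
assert (B0 : 0 < B).
{ unfold B; rewrite Cmod_Cexp; apply Rmult_lt_0_compat; [|apply exp_pos].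
  assert (P := exp_pos 2); lra. }
destruct (dlim (Rmin 1 (eps / 2 / B))) as [m2 H2].
{ apply Rmin_pos; [lra|]; apply Rdiv_lt_0_compat; lra. }
exists (m1 + m2)%nat; intros m Hm.
specialize (H1 m ltac:(lia)); specialize (H2 m ltac:(lia)).
assert (F := INR_fact_lt_0 m).
unfold Rdist in H1; rewrite Rminus_0_r, Rabs_pos_eq in H1.
2: { apply Rmult_le_pos; [apply pow_le; lra | apply Rlt_le, Rinv_0_lt_compat; lra]. }
replace (Cminus (exp_sum _ _) _) with
  (Cplus (Cminus (exp_sum (log_trunc z m) (Datatypes.S m)) (Cexp (log_trunc z m)))
     (Cmult (Cexp (Copp S)) (Cminus (Cexp (d m)) (RtoC 1)))).
2: { replace (Cexp (log_trunc z m)) with (Cmult (Cexp (Copp S)) (Cexp (d m))); [ring|].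
     rewrite <- Cexp_plus; f_equal; unfold d; ring. }
eapply Rle_lt_trans; [apply Cmod_triangle|].
assert (L1 : Cmod (Cminus (exp_sum (log_trunc z m) (Datatypes.S m)) (Cexp (log_trunc z m))) < eps / 2).
{ eapply Rle_lt_trans; [apply Cexp_taylor|].
  apply Rle_lt_trans with (A * ((2 * K) ^ m / INR (fact m))).
  - unfold A; replace (2 * exp (2 * (2 * K)) * (2 * K) * ((2 * K) ^ m / INR (fact m))) with
      (2 * (exp (2 * (2 * K)) * ((2 * K) ^ Datatypes.S m / INR (fact m)))) by (simpl; field; lra).
    apply Rmult_le_compat_l; [lra|]; apply Rmult_le_compat.
    + apply Rlt_le, exp_pos.
    + apply Rmult_le_pos; [apply pow_le, Cmod_ge_0 | apply Rlt_le, Rinv_0_lt_compat; lra].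
    + destruct (Rle_lt_or_eq_dec _ _ (bnd m)) as [Q|Q]; [|rewrite Q; lra].
      apply Rlt_le, exp_increasing; lra.
    + apply Rmult_le_compat_r; [apply Rlt_le, Rinv_0_lt_compat; lra|].
      apply pow_incr; split; [apply Cmod_ge_0 | apply bnd].
  - apply (Rmult_lt_compat_l A) in H1; [|exact A0].
    replace (A * (eps / 2 / A)) with (eps / 2) in H1 by (field; lra); exact H1. }
assert (L2 : Cmod (Cmult (Cexp (Copp S)) (Cminus (Cexp (d m)) (RtoC 1))) < eps / 2).
{ rewrite Cmod_mult.
  apply Rle_lt_trans with (B * Cmod (d m)).
  - unfold B; assert (Q := Cexp_lipschitz (d m)).
    assert (D1 : Cmod (d m) < 1) by (eapply Rlt_le_trans; [exact H2|apply Rmin_l]).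
    assert (D0 := Cmod_ge_0 (d m)).
    assert (exp (2 * Cmod (d m)) <= exp 2) by (apply Rlt_le, exp_increasing; lra).
    assert (P := Cmod_ge_0 (Cexp (Copp S))).
    replace (2 * exp 2 * Cmod (Cexp (Copp S)) * Cmod (d m)) with
      (Cmod (Cexp (Copp S)) * (2 * (exp 2 * Cmod (d m)))) by ring.
    apply Rmult_le_compat_l; [easy|]; nra.
  - assert (D2 : Cmod (d m) < eps / 2 / B) by (eapply Rlt_le_trans; [exact H2|apply Rmin_r]).
    apply (Rmult_lt_compat_l B) in D2; [|exact B0].
    replace (B * (eps / 2 / B)) with (eps / 2) in D2 by (field; lra); exact D2. }
lra.
Qed.

(** Splitting off the first term leaves 1/p times the series at z^p, so p S = S' + Log(1 - z^p); the
    p-th power of Cexp(-S) therefore contains no root whose branch would matter. *)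
Lemma Tp_mahler z S S' : Cmod z < 1 ->
  @is_series C_AbsRing C_NormedModule (Tp_log_term p z) S ->
  @is_series C_AbsRing C_NormedModule (Tp_log_term p (Cpow z p)) S' ->
  Cexp (Copp S') = Cmult (Cminus (RtoC 1) (Cpow z p)) (Cpow (Cexp (Copp S)) p).
Proof.
intros Hz HS HS'; set (w := Cminus (RtoC 1) (Cpow z p)).
assert (np : RtoC (INR p) <> RtoC 0).
{ intros E; apply (not_0_INR p); [lia | now injection E]. }
assert (E : S = Cplus (Cmult (RtoC (/ INR p)) S') (Cmult (RtoC (/ INR p)) (CLog w))).
{ apply (is_series_C_unique _ _ _ HS).
  apply is_series_decr_1.
  match goal with |- is_series _ ?l => replace l with (scal (RtoC (/ INR p) : C_Ring) (S' : C_NormedModule)) end.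
  - apply is_series_ext with (2 := is_series_scal (RtoC (/ INR p) : C_Ring) _ _ HS').
    intros k; change (Cmult (RtoC (/ INR p)) (Tp_log_term p (Cpow z p) k) = Tp_log_term p z (Datatypes.S k)).
    unfold Tp_log_term; rewrite <- Cpow_mult_r.
    replace (p ^ Datatypes.S (Datatypes.S k))%nat with (p * p ^ Datatypes.S k)%nat by easy.
    rewrite mult_INR, Rinv_mult, RtoC_mult; ring.
  - change (Cmult (RtoC (/ INR p)) S' = Cplus (Cplus (Cmult (RtoC (/ INR p)) S')
      (Cmult (RtoC (/ INR p)) (CLog w))) (Copp (Tp_log_term p z 0))).
    unfold Tp_log_term, w; rewrite Nat.pow_1_r; ring. }
rewrite Cexp_INR_mult, E.
replace (Cmult (RtoC (INR p)) _) with (Cplus (Copp (CLog w)) (Copp S')).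
2: { rewrite RtoC_inv by (apply not_0_INR; lia); field; exact np. }
rewrite Cexp_plus, Cmult_assoc.
rewrite <- (Cexp_CLog w) at 1.
- rewrite <- Cexp_plus; replace (Cplus (CLog w) (Copp (CLog w))) with (RtoC 0) by ring.
  rewrite Cexp_0; ring.
- assert (H := Cmod_pow_p z 1 Hz); rewrite Nat.pow_1_r in H.
  assert (H1 := re_le_Cmod (Cpow z p)); assert (H2 := Rle_abs (Re (Cpow z p))).
  unfold w, Re in *; simpl; lra.
Qed.

End LogSeries.

Module Mahler.
Import all_boot all_order fingroup perm all_algebra separable cyclotomic.
Import complex reals Rstruct ring lra zify.
Import Order.TTheory GRing.Theory Num.Theory.
Local Open Scope ring_scope.
Set Implicit Arguments.
Unset Strict Implicit.
Unset Printing Implicit Defensive.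

(** * The modulus on R[i] *)

Section Abs.
Variable R : rcfType.
Implicit Types (x : R) (z : R[i]).

(** The norm of [R[i]] takes its values in [R[i]]; a modulus in the real field makes order and real
    arithmetic available. *)
Definition abs z : R := Normc.normc z.

Lemma normE z : `|z| = (abs z)%:C%C.
Proof. by []. Qed.

Lemma abs_ge0 z : 0 <= abs z.
Proof. by rewrite -lecR -normE normr_ge0. Qed.

Lemma abs0 : abs 0 = 0.
Proof. exact: Normc.normc0. Qed.

Lemma abs1 : abs 1 = 1.
Proof. exact: Normc.normc1. Qed.

Lemma absM z1 z2 : abs (z1 * z2) = abs z1 * abs z2.
Proof. exact: Normc.normcM. Qed.

Lemma absN z : abs (- z) = abs z.
Proof. exact: normcN. Qed.

Lemma absD z1 z2 : abs (z1 + z2) <= abs z1 + abs z2.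
Proof. exact: le_normcD. Qed.

Lemma absB z1 z2 : abs (z1 - z2) <= abs z1 + abs z2.
Proof. by rewrite -(absN z2); exact: absD. Qed.

Lemma abs_distC z1 z2 : abs (z1 - z2) = abs (z2 - z1).
Proof. by rewrite -absN opprB. Qed.

Lemma abs_eq0 z : (abs z == 0) = (z == 0).
Proof. by apply/eqP/eqP => [/Normc.eq0_normc|->]; rewrite ?abs0. Qed.

Lemma abs_gt0 z : (0 < abs z) = (z != 0).
Proof. by rewrite lt_def abs_eq0 abs_ge0 andbT. Qed.

Lemma absX z n : abs (z ^+ n) = abs z ^+ n.
Proof. by elim: n => [|n IH]; rewrite ?abs1 // !exprS absM IH. Qed.

Lemma abs_prod (I : Type) (r : seq I) (P : pred I) (f : I -> R[i]) :
  abs (\prod_(i <- r | P i) f i) = \prod_(i <- r | P i) abs (f i).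
Proof. by elim/big_rec2: _ => [|i x y _ <-]; rewrite ?abs1 ?absM. Qed.

Lemma abs_sum (I : Type) (r : seq I) (P : pred I) (f : I -> R[i]) :
  abs (\sum_(i <- r | P i) f i) <= \sum_(i <- r | P i) abs (f i).
Proof.
elim/big_rec2: _ => [|i x y _ le_xy]; first by rewrite abs0.
by apply: le_trans (absD _ _) _; rewrite lerD2l.
Qed.

Lemma abs_real x : abs x%:C%C = `|x|.
Proof. by rewrite /abs /= expr0n addr0 sqrtr_sqr. Qed.

Lemma abs_ratr (q : rat) : abs (ratr q) = ratr `|q|.
Proof.
have <- : (ratr q : R)%:C%C = ratr q by exact: (fmorph_eq_rat (real_complex R \o ratr) q).
by rewrite abs_real ratr_norm.
Qed.

Lemma abs_nat (n : nat) : abs n%:R = n%:R.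
Proof. by rewrite -[n%:R in LHS]ratr_nat abs_ratr ger0_norm ?ler0n // ratr_nat. Qed.

Lemma abs_int (n : int) : abs n%:~R = `|n|%N%:R.
Proof. by rewrite -ratr_int abs_ratr -intr_norm ratr_int natr_absz. Qed.

End Abs.

(** * A Liouville inequality *)

Lemma abszD_le (a b : int) : (`|(a + b)%R| <= `|a| + `|b|)%N.
Proof. by lia. Qed.

(** The row-sum norm is submultiplicative, so the bounds multiply exactly. Entrywise bounds would
    cost a factor of the dimension at each of the roughly q products. *)
Definition row_bounded m n (G : 'M[int]_(m, n)) (L : nat) :=
  forall i, (\sum_j `|G i j|%N <= L)%N.

Lemma det_le m (G : 'M[int]_m) (L : nat) :
  (forall i j, `|G i j|%N <= L)%N -> (`|\det G|%N <= m`! * L ^ m)%N.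
Proof.
move=> hG; rewrite -lez_nat abszE; apply: le_trans (ler_norm_sum _ _ _) _.
have -> : (m`! * L ^ m)%N = (\sum_(s : 'S_m) L ^ m)%N.
  by rewrite sum_nat_const card_Sn.
rewrite -natz natr_sum; apply: ler_sum => s _.
rewrite normrM normrX normrN1 expr1n mul1r normr_prod.
rewrite -[X in (L ^ X)%N]card_ord -prod_nat_const natr_prod.
by apply: ler_prod => i _; rewrite normr_ge0 /= -abszE natz lez_nat.
Qed.

Lemma adj_le m (G : 'M[int]_m) (L : nat) i j :
  (forall i j, `|G i j|%N <= L)%N -> (`|(\adj G) i j|%N <= m.-1`! * L ^ m.-1)%N.
Proof.
move=> hG; rewrite mxE /cofactor abszM abszX abszN exp1n mul1n.
by apply: det_le => k l; rewrite !mxE.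
Qed.

Section Bound.
Variables (R : rcfType) (D : nat) (w : 'cV[R[i]]_D) (e : nat).
Hypotheses (w_neq0 : w != 0) (e_gt0 : (0 < e)%N).
Hypothesis w_free : forall v : 'rV[rat]_D, map_mx ratr v *m w = 0 -> v = 0.

(** [repr d L y] says that [y] has house and denominator controlled by [L] and [e ^ d]: multiplication
    by [e ^ d * y] is given in the coordinates of [w] by an integer matrix with row sums at most [L]. *)
Definition repr (d L : nat) (y : R[i]) := exists2 G : 'M[int]_D,
  row_bounded G L & map_mx intr G *m w = (e ^ d)%:R * y *: w.

Lemma repr_int (n : int) : repr 0 `|n|%N n%:~R.
Proof.
exists (n%:M).
  move=> i; rewrite (bigD1 i) //= big1 ?addn0 ?mxE ?eqxx // => j ji.
  by rewrite mxE eq_sym (negPf ji).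
by rewrite map_scalar_mx mul_scalar_mx expn0 mul1r.
Qed.

Lemma repr_le d L L' y : (L <= L')%N -> repr d L y -> repr d L' y.
Proof. by move=> le_LL [G hG eG]; exists G => // i; apply: leq_trans le_LL. Qed.

Lemma repr_deg d d' L y : (d <= d')%N -> repr d L y -> repr d' (e ^ (d' - d) * L) y.
Proof.
move=> le_dd [G hG eG]; exists ((e ^ (d' - d))%:Z *: G).
  move=> i; under eq_bigr do rewrite mxE abszM absz_nat.
  by rewrite -big_distrr leq_mul.
rewrite map_mxZ /= -scalemxAl eG scalerA mulrA.
by rewrite -[(_ ^ _)%N%:~R]/((e ^ (d' - d))%:R) -natrM -expnD subnK.
Qed.

Lemma repr_add d L1 L2 y1 y2 :
  repr d L1 y1 -> repr d L2 y2 -> repr d (L1 + L2) (y1 + y2).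
Proof.
move=> [G1 h1 e1] [G2 h2 e2]; exists (G1 + G2).
  move=> i; apply: leq_trans (leq_add (h1 i) (h2 i)).
  by rewrite -big_split /= leq_sum // => j _; rewrite mxE abszD_le.
by rewrite map_mxD mulmxDl e1 e2 -scalerDl -mulrDr.
Qed.

Lemma repr_mul d1 d2 L1 L2 y1 y2 :
  repr d1 L1 y1 -> repr d2 L2 y2 -> repr (d1 + d2) (L1 * L2) (y1 * y2).
Proof.
move=> [G1 h1 e1] [G2 h2 e2]; exists (G2 *m G1); last first.
  by rewrite map_mxM -mulmxA e1 -scalemxAr e2 scalerA expnD natrM mulrACA.
move=> i; rewrite mulnC; apply: (@leq_trans (\sum_k `|G2 i k|%N * L1)%N); last first.
  by rewrite -big_distrl leq_mul.
apply: (@leq_trans (\sum_j \sum_k `|G2 i k|%N * `|G1 k j|%N)%N).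
  apply: leq_sum => j _; rewrite mxE.
  elim/big_rec2: _ => // k x z _ le_zx; apply: leq_trans (abszD_le _ _) _.
  by rewrite abszM leq_add2l.
by rewrite exchange_big leq_sum // => k _; rewrite -big_distrr leq_mul.
Qed.

Lemma repr_exp d L y n : repr d L y -> repr (d * n) (L ^ n) (y ^+ n).
Proof.
move=> h; elim: n => [|n IH]; first by rewrite muln0; exact: (repr_int 1).
by rewrite mulnS expnS exprS; apply: repr_mul.
Qed.

Lemma repr_sum (I : Type) (r : seq I) (P : pred I) d (L : I -> nat) y :
  (forall i, P i -> repr d (L i) (y i)) ->
  repr d (\sum_(i <- r | P i) L i) (\sum_(i <- r | P i) y i).
Proof.
move=> h; elim/big_rec2: _ => [|i x z Pi hx]; last exact: repr_add (h i Pi) hx.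
by have := repr_deg (leq0n d) (repr_int 0); rewrite muln0.
Qed.

(** [\adj G *m G *m w = \det G *: w] bounds [|\det G|] by a multiple of [|y|], and [\det G] is a
    non-zero integer because [w] is rationally free. *)
Lemma repr_lower_bound : exists2 kappa : R, 0 < kappa &
  forall d L y, repr d L y -> y != 0 -> kappa <= (L ^ D * e ^ d)%:R * abs y.
Proof.
have /matrix0Pn[i0 [j0]] := w_neq0; rewrite (ord1 j0) => wi0 {j0}.
have D_gt0 : (0 < D)%N := leq_ltn_trans (leq0n i0) (ltn_ord i0).
pose s := \sum_j abs (w j 0).
have s_gt0 : 0 < s.
  by rewrite /s (bigD1 i0) //= ltr_wpDr ?sumr_ge0 ?abs_gt0 // => *; apply: abs_ge0.
have fact_gt : (0 : R) < (D.-1`!)%:R by rewrite ltr0n fact_gt0.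
exists (abs (w i0 0) / (D.-1`!%:R * s)).
  by rewrite divr_gt0 ?mulr_gt0 ?abs_gt0.
move=> d L y [G hG eG] y_neq0.
have ed_neq0 : (e ^ d)%:R * y != 0 :> R[i].
  by rewrite mulf_neq0 // pnatr_eq0 -lt0n expn_gt0 e_gt0.
have detG : \det G != 0.
  apply/eqP => detG0.
  have /det0P[v v_neq0 vG] : \det (map_mx intr G : 'M[rat]_D) == 0.
    by rewrite det_map_mx detG0.
  case/eqP: v_neq0; apply: w_free; apply/eqP.
  have /eqP : map_mx ratr (v *m map_mx intr G) *m w = 0 by rewrite vG map_mx0 mul0mx.
  have ratrG : map_mx ratr (map_mx intr G) = map_mx intr G :> 'M[R[i]]_D.
    by apply/matrixP => i j; rewrite !mxE ratr_int.
  by rewrite map_mxM -mulmxA ratrG eG -scalemxAr scaler_eq0 (negPf ed_neq0).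
have L_gt0 : (0 < L)%N.
  rewrite lt0n; apply: contraNneq detG => L0.
  rewrite (expand_det_row G i0) big1 // => j _.
  have := hG i0; rewrite L0 leqn0 sum_nat_eq0 => /forallP/(_ j).
  by rewrite absz_eq0 => /eqP->; rewrite mul0r.
have hent i j : (`|G i j|%N <= L)%N.
  by apply: leq_trans (hG i); rewrite (bigD1 j) //= leq_addr.
have key : (\det G)%:~R * w i0 0 =
    (e ^ d)%:R * y * \sum_j ((\adj G) i0 j)%:~R * w j 0.
  have := congr1 (fun A => (map_mx intr (\adj G) *m A) i0 0) eG.
  rewrite mulmxA -map_mxM mul_adj_mx map_scalar_mx mul_scalar_mx mxE => ->.
  by rewrite -scalemxAr !mxE; under eq_bigr do rewrite mxE.
have le1 : abs (w i0 0) <= abs ((\det G)%:~R * w i0 0).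
  by rewrite absM abs_int ler_peMl ?abs_ge0 // ler1n absz_gt0.
rewrite ler_pdivrMr ?mulr_gt0 //; apply: le_trans le1 _.
rewrite key !absM abs_nat natrM.
have le2 : abs (\sum_j ((\adj G) i0 j)%:~R * w j 0) <= (D.-1`! * L ^ D.-1)%:R * s.
  apply: le_trans (abs_sum _ _ _) _; rewrite /s mulr_sumr; apply: ler_sum => j _.
  by rewrite absM ler_wpM2r ?abs_ge0 // abs_int ler_nat adj_le.
apply: le_trans (ler_wpM2l _ le2) _; first by rewrite mulr_ge0 ?abs_ge0 ?ler0n.
have -> : (L ^ D)%:R * (e ^ d)%:R * abs y * (D.-1`!%:R * s) =
    (e ^ d)%:R * abs y * ((D.-1`! * L ^ D)%:R * s) by rewrite natrM; ring.
rewrite ler_wpM2l ?mulr_ge0 ?abs_ge0 ?ler0n // ler_wpM2r ?(ltW s_gt0) //.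
by rewrite ler_nat leq_mul2l leq_pexp2l ?leq_pred ?orbT.
Qed.

End Bound.

(** * A common rational eigenvector for two algebraic numbers *)

Section Stable.
Variable R : rcfType.

(** Multiplication by [a] preserves the rational span of the entries of [w]. One vector serves
    several numbers, so sums and products of numbers become those of matrices. *)
Definition stable D (w : 'cV[R[i]]_D) (a : R[i]) :=
  exists A : 'M[rat]_D, map_mx ratr A *m w = a *: w.

Definition rat_free D (w : 'cV[R[i]]_D) :=
  forall v : 'rV[rat]_D, map_mx ratr v *m w = 0 -> v = 0.

(** A rational relation with [v 0 i != 0] expresses entry [i] through the others; [Z] performs this
    substitution, and [row' i A *m Z] is the matrix of [a] on the shortened vector. *)
Lemma stable_drop D (w : 'cV[R[i]]_D.+1) (v : 'rV[rat]_D.+1) i :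
  map_mx ratr v *m w = 0 -> v 0 i != 0 ->
  exists2 Z : 'M[rat]_(D.+1, D), map_mx ratr Z *m row' i w = w &
    forall a, stable w a -> stable (row' i w) a.
Proof.
move=> vw0 vi.
pose Z : 'M[rat]_(D.+1, D) := \matrix_(k, j)
  (if unlift i k is Some l then (l == j)%:R else - (v 0 (lift i j) / v 0 i)).
have eZ : map_mx ratr Z *m row' i w = w.
  apply/colP => k; rewrite mxE; under eq_bigr do rewrite !mxE.
  case: unliftP => [l ->|->].
    rewrite (bigD1 l) //= eqxx rmorph1 mul1r big1 ?addr0 // => j jl.
    by rewrite eq_sym (negPf jl) rmorph0 mul0r.
  have := congr1 (fun M : 'M_1 => M 0 0) vw0; rewrite !mxE (bigD1_ord i) //=.
  move=> /eqP; rewrite addr_eq0 mxE => /eqP e1.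
  have vi' : ratr (v 0 i) != 0 :> R[i] by rewrite fmorph_eq0.
  apply: (mulfI vi'); rewrite e1 mulr_sumr -sumrN; apply: eq_bigr => j _.
  by rewrite rmorphN rmorphM fmorphV !mxE /=; field.
exists Z => // a [A eA]; exists (row' i A *m Z).
rewrite map_mxM -mulmxA eZ.
have -> : a *: row' i w = row' i (a *: w) by apply/matrixP => k l; rewrite !mxE.
rewrite -eA; apply/matrixP => k l; rewrite !mxE; apply: eq_bigr => j _.
by rewrite !mxE.
Qed.

(** A shortest non-zero [w] is rationally free; this replaces choosing a basis of the number field
    generated by [a] and [b]. *)
Lemma stable_reduce D (w : 'cV[R[i]]_D) a b :
  w != 0 -> stable w a -> stable w b ->
  exists D' (w' : 'cV[R[i]]_D'), [/\ w' != 0, rat_free w', stable w' a & stable w' b].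
Proof.
elim: D w => [ |D IH] w w0 sa sb.
  by case/eqP: w0; apply/colP; case.
case: (boolp.pselect (rat_free w)) => [fw|nfw]; first by exists D.+1, w.
have [v [vw0 v0] ] : exists v : 'rV[rat]_D.+1, map_mx ratr v *m w = 0 /\ v <> 0.
  apply: boolp.contrapT => nex; apply: nfw => v vw0; apply: boolp.contrapT => v0.
  by apply: nex; exists v.
have /matrix0Pn[k [j]] : v != 0 by apply/eqP.
rewrite (ord1 k) => vj; have [Z eZ sZ] := stable_drop vw0 vj.
apply: (IH (row' j w)); [|exact: sZ|exact: sZ].
by apply: contra_neq w0 => w'0; rewrite -eZ w'0 mulmx0.
Qed.

Definition rat_span D (w : 'cV[R[i]]_D) (y : R[i]) :=
  exists v : 'rV[rat]_D, (map_mx ratr v *m w) 0 0 = y.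

Lemma rat_span_sum D (w : 'cV[R[i]]_D) n (c : 'I_n -> rat) (y : 'I_n -> R[i]) :
  (forall l, rat_span w (y l)) -> rat_span w (\sum_l ratr (c l) * y l).
Proof.
move=> h; have [v hv] := fin_all_exists h; exists (\sum_l c l *: v l).
rewrite raddf_sum mulmx_suml summxE; apply: eq_bigr => l _.
by rewrite /= map_mxZ -scalemxAl mxE hv.
Qed.

Lemma stableP D (w : 'cV[R[i]]_D) a :
  (forall k, rat_span w (a * w k 0)) -> stable w a.
Proof.
move=> h; have [v hv] := fin_all_exists h; exists (\matrix_k v k).
apply/colP => k; rewrite !mxE -hv mxE; apply: eq_bigr => j _.
by rewrite !mxE.
Qed.

Lemma algebraic_power a : algebraicOver (ratr : rat -> R[i]) a ->
  exists n (c : 'I_n -> rat), (0 < n)%N /\ a ^+ n = \sum_i ratr (c i) * a ^+ i.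
Proof.
case=> f f0 ra; have [n sf] : exists n, size f = n.+1.
  by case: (size f) (size_poly_gt0 f) => [|n]; rewrite ?f0 //; exists n.
have lf : ratr f`_n != 0 :> R[i].
  by rewrite fmorph_eq0 -[n]/n.+1.-1 -sf -lead_coefE lead_coef_eq0.
exists n, (fun i => - (f`_i / f`_n)); split.
  rewrite lt0n; apply/eqP => n0; move: ra lf; rewrite n0 in sf *.
  have [c c0 ->] := size_poly1P f (introT eqP sf).
  by rewrite rootE map_polyC hornerC coefC /= => ->.
move: ra; rewrite rootE horner_coef size_map_poly sf big_ord_recr /= coef_map /=.
rewrite addrC addr_eq0 => /eqP e1; apply: (mulfI lf); rewrite e1 mulr_sumr -sumrN.
apply: eq_bigr => i _; rewrite coef_map /= rmorphN rmorphM fmorphV.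
by rewrite mulNr mulrN mulrA [_ * (_ / _)]mulrCA mulfV // mulr1.
Qed.

(** The monomials a^i b^j below the degrees n and m of the two relations span a space stable under
    both numbers. They may be rationally dependent, which is why [stable_reduce] follows. *)
Lemma stable_exists a b : algebraicOver (ratr : rat -> R[i]) a ->
  algebraicOver (ratr : rat -> R[i]) b ->
  exists D (w : 'cV[R[i]]_D), [/\ w != 0, rat_free w, stable w a & stable w b].
Proof.
move=> /algebraic_power[n [c [n0 ec]]] /algebraic_power[m [d [m0 ed]]].
pose w : 'cV[R[i]]_(n * m) := \col_(k < n * m) (a ^+ (k %/ m) * b ^+ (k %% m)).
have mon i j : (i < n)%N -> (j < m)%N -> rat_span w (a ^+ i * b ^+ j).
  move=> ltin ltjm; have lt_nm : (i * m + j < n * m)%N.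
    by rewrite (@leq_trans (i.+1 * m)) ?leq_mul2r ?ltin ?orbT // mulSn addnC ltn_add2r.
  exists (delta_mx 0 (Ordinal lt_nm)); rewrite map_delta_mx -rowE !mxE /=.
  by rewrite divnMDl // divn_small // addn0 modnMDl modn_small.
have hdiv (k : 'I_(n * m)) : (k %/ m < n)%N by rewrite ltn_divLR.
have hmod (k : 'I_(n * m)) : (k %% m < m)%N by rewrite ltn_mod.
apply: (@stable_reduce _ w); [|apply: stableP => k..].
- have lt0 : (0 < n * m)%N by rewrite muln_gt0 n0.
  apply/matrix0Pn; exists (Ordinal lt0), 0.
  by rewrite mxE /= div0n mod0n mulr1 oner_neq0.
- rewrite mxE mulrA -exprS; have [lt|] := ltnP (k %/ m).+1 n; first exact: mon.
  move=> ge; have -> : (k %/ m).+1 = n by apply/eqP; rewrite eqn_leq ge hdiv.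
  rewrite ec mulr_suml; under eq_bigr do rewrite -mulrA.
  by apply: rat_span_sum => l; apply: mon.
- rewrite mxE mulrCA -exprS; have [lt|] := ltnP (k %% m).+1 m; first exact: mon.
  move=> ge; have -> : (k %% m).+1 = m by apply/eqP; rewrite eqn_leq ge hmod.
  rewrite ed mulr_sumr; under eq_bigr do rewrite mulrCA.
  by apply: rat_span_sum => l; apply: mon.
Qed.

End Stable.

(** * Liouville's inequality at the Mahler iterates *)

Lemma leq_expr m n e : (m <= n)%N -> (m ^ e <= n ^ e)%N.
Proof. by case: e => // e; rewrite leq_exp2r. Qed.

Section Bound.
Variable R : rcfType.
Implicit Types a b : R[i].

(** Admitting every multiple [e] of [e0] lets two numbers share one denominator. *)
Lemma repr_of_stable D (w : 'cV[R[i]]_D) a : stable w a ->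
  exists2 e0 : nat, (0 < e0)%N &
    forall e, (0 < e)%N -> (e0 %| e)%N -> exists c, repr w e 1 c a.
Proof.
case=> A eA; exists (\prod_(ij : 'I_D * 'I_D) `|denq (A ij.1 ij.2)|)%N.
  by rewrite prodn_gt0 // => ij; rewrite absz_gt0 denq_neq0.
move=> e e_gt0 dvd_e.
have hG i j : exists n : int, n%:~R = e%:R * A i j.
  have /dvdnP[m ->] : (`|denq (A i j)| %| e)%N.
    by apply: dvdn_trans dvd_e; rewrite (bigD1 (i, j)) //= dvdn_mulr.
  exists (m%:Z * numq (A i j)).
  have den0 : (denq (A i j))%:~R != 0 :> rat by rewrite intr_eq0 denq_neq0.
  have num : A i j * (denq (A i j))%:~R = (numq (A i j))%:~R.
    by rewrite -[X in X * _]divq_num_den mulfVK.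
  rewrite rmorphM /= -num natrM natr_absz ger0_norm ?denq_ge0 //.
  by rewrite -[m%:Z%:~R]/(m%:R); ring.
have [G eG] := fin_all_exists (fun i => fin_all_exists (hG i)).
pose G' : 'M[int]_D := \matrix_(i, j) G i j.
exists (\sum_i \sum_j `|G' i j|)%N; exists G'.
  by move=> i; rewrite [X in (_ <= X)%N](bigD1 i) //= leq_addr.
rewrite expn1 -scalerA -eA scalemxAl; congr (_ *m w).
apply/matrixP => i j; rewrite !mxE -ratr_int eG rmorphM /= ratr_nat.
by [].
Qed.

Lemma common_repr a b : algebraicOver (ratr : rat -> R[i]) a ->
  algebraicOver (ratr : rat -> R[i]) b ->
  exists D (w : 'cV[R[i]]_D) e c, [/\ w != 0, rat_free w, (0 < e)%N,
    repr w e 1 c a & repr w e 1 c b].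
Proof.
move=> ha hb; have [D [w [w0 fw sa sb]]] := stable_exists ha hb.
have [e1 e1_gt0 h1] := repr_of_stable sa.
have [e2 e2_gt0 h2] := repr_of_stable sb.
have e_gt0 : (0 < e1 * e2)%N by rewrite muln_gt0 e1_gt0.
have [c1 r1] := h1 _ e_gt0 (dvdn_mulr _ (dvdnn _)).
have [c2 r2] := h2 _ e_gt0 (dvdn_mull _ (dvdnn _)).
exists D, w, (e1 * e2)%N, (c1 + c2)%N; split=> //.
  by apply: repr_le r1; rewrite leq_addr.
by apply: repr_le r2; rewrite leq_addl.
Qed.

(** The value of [T (a ^ (p ^ k))] when [b = T a]. *)
Definition mahler_iter (p k : nat) a b : R[i] :=
  b ^+ (p ^ k) * \prod_(j < k) (1 - a ^+ (p ^ j.+1)) ^+ (p ^ (k - j.+1)).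

Definition eval2 (M N : nat) (x : 'I_M.+1 -> 'I_N.+1 -> int) (u v : R[i]) : R[i] :=
  \sum_i \sum_j (x i j)%:~R * (u ^+ i * v ^+ j).

(** In [mahler_iter] each of the k factors has degree p^(j+1) p^(k-j-1) = p^k in [a], and [b] has
    exponent p^k: in all (k + 1) p^k. A monomial u^i v^j then has degree at most (M + N (k + 1))
    p^k, the exponent of [E]. *)
Lemma mahler_lower_bound p a b : (0 < p)%N ->
  algebraicOver (ratr : rat -> R[i]) a -> algebraicOver (ratr : rat -> R[i]) b ->
  exists D E (kappa : R), [/\ (0 < E)%N, 0 < kappa &
  forall k M N H (x : 'I_M.+1 -> 'I_N.+1 -> int), (forall i j, `|x i j|%N <= H)%N ->
  let y := eval2 x (a ^+ (p ^ k)) (mahler_iter p k a b) in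
  y != 0 ->
  kappa <= ((M.+1 * N.+1 * H) ^ D * E ^ ((M + N * k.+1) * p ^ k))%:R * abs y].
Proof.
move=> p_gt0 ha hb; have [D [w [e [c [w0 fw e_gt0 ra rb]]]]] := common_repr ha hb.
have [kappa kappa_gt0 lowb] := repr_lower_bound w0 e_gt0 fw.
(* Since e^m + c^m <= g^m for m > 0, the factor 1 - a^m gets the same bound g^m as a^m, and products
   only add exponents. Finally [g ^ D.+1] absorbs both L^D and e^d. *)
pose g := (e + c)%N; have le_eg : (e <= g)%N by rewrite leq_addr.
have g_gt0 : (0 < g)%N := leq_trans e_gt0 le_eg.
have pX_gt0 j : (0 < p ^ j)%N by rewrite expn_gt0 p_gt0.
exists D, (g ^ D.+1)%N, kappa; split=> //; first by rewrite expn_gt0 g_gt0.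
move=> k M N H x hx y y0; set d := ((M + N * k.+1) * p ^ k)%N.
have rX u m : repr w e 1 c u -> repr w e m (g ^ m) (u ^+ m).
  move=> ru; rewrite -[m in repr _ _ m]mul1n.
  by apply: repr_le (repr_exp m ru); rewrite leq_expr ?leq_addl.
have r1B m : (0 < m)%N -> repr w e m (g ^ m) (1 - a ^+ m).
  move=> m_gt0; have r1 := repr_deg (leq0n m) (repr_int w e 1).
  have rN := repr_mul (repr_int w e (-1)) (repr_exp m ra).
  rewrite mul1n add0n abszN !mul1n mulN1r in rN.
  apply: repr_le (repr_add r1 rN); rewrite subn0 muln1.
  case: m m_gt0 {r1 rN} => // m _; rewrite /g !expnS mulnDl leq_add // leq_mul2l.
    by rewrite leq_expr ?orbT // leq_addr.
  by rewrite leq_expr ?orbT // leq_addl.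
have rit : repr w e (k.+1 * p ^ k) (g ^ (k.+1 * p ^ k)) (mahler_iter p k a b).
  rewrite mulSn expnD; apply: repr_mul (rX _ _ rb) _.
  suff h n : (n <= k)%N -> repr w e (n * p ^ k) (g ^ (n * p ^ k))
      (\prod_(j < n) (1 - a ^+ (p ^ j.+1)) ^+ (p ^ (k - j.+1))) by exact: h.
  elim: n => [|n IH] ltnk; first by rewrite big_ord0; exact: (repr_int w e 1).
  rewrite big_ord_recr /= mulSn addnC expnD; apply: repr_mul (IH (ltnW ltnk)) _.
  have := repr_exp (p ^ (k - n.+1)) (r1B (p ^ n.+1)%N (pX_gt0 _)).
  by rewrite -expnM -expnD subnKC.
have ry : repr w e d (M.+1 * N.+1 * H * g ^ d) y.
  have -> : (M.+1 * N.+1 * H * g ^ d = \sum_(i < M.+1) \sum_(j < N.+1) H * g ^ d)%N.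
    by rewrite !sum_nat_const !card_ord !mulnA.
  apply: repr_sum => i _; apply: repr_sum => j _.
  have := repr_mul (repr_int w e (x i j)) (repr_mul (rX _ (p ^ k * i)%N ra) (repr_exp j rit)).
  rewrite add0n -exprM -expnM -expnD.
  set d' := (_ + _)%N => r.
  have le_dd : (d' <= d)%N.
    have := ltn_ord i; have := ltn_ord j; rewrite !ltnS => le_j le_i.
    rewrite /d' /d mulnDl mulnC leq_add ?leq_mul2r ?le_i ?orbT //.
    by rewrite mulnC mulnA leq_mul2r leq_mul2r le_j !orbT.
  apply: repr_le (repr_deg le_dd r); rewrite mulnCA leq_mul //.
  by rewrite -(subnK le_dd) expnD subnK // leq_mul2r leq_expr ?orbT.
apply: le_trans (lowb _ _ _ ry y0) _; rewrite ler_wpM2r ?abs_ge0 // ler_nat.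
rewrite expnMn -mulnA leq_mul2l; apply/orP; right.
rewrite -!expnM -/d [(D.+1 * d)%N]mulSn expnD mulnC leq_mul ?leq_expr //.
by rewrite mulnC.
Qed.

End Bound.

(** * Siegel's lemma *)

(** Pigeonhole on the box [0, H]^I, with H = (2 |I| a)^|J|. A single unknown in excess is assumed,
    whence this crude exponent: the number of value vectors is at most (2 |I| a (H + 1))^|J| = H (H
    + 1)^|J| < (H + 1)^(|J| + 1). *)
Lemma siegel (I J : finType) (A : J -> I -> int) (a : nat) :
  (0 < a)%N -> (#|J| < #|I|)%N -> (forall j i, `|A j i|%N <= a)%N ->
  exists x : I -> int, [/\ exists i, x i != 0,
    forall i, (`|x i|%N <= (2 * #|I| * a) ^ #|J|)%N &
    forall j, \sum_i A j i * x i = 0].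
Proof.
move=> a_gt0 ltJI hA; set H := ((2 * #|I| * a) ^ #|J|)%N.
pose val (f : {ffun I -> 'I_H.+1}) j : int := \sum_i A j i * (f i)%:Z.
pose B := (#|I| * (a * H))%N.
have valB f j : `|val f j| <= B%:Z.
  apply: le_trans (ler_norm_sum _ _ _) _.
  apply: (@le_trans _ _ (\sum_(i : I) (a * H)%N%:Z)); last first.
    by rewrite sumr_const /B -mulr_natl natz -PoszM.
  apply: ler_sum => i _; rewrite -abszE lez_nat abszM absz_nat leq_mul //.
  by rewrite -ltnS.
pose code (f : {ffun I -> 'I_H.+1}) : {ffun J -> 'I_(2 * B).+1} :=
  [ffun j => inord `|(val f j + B%:Z)%R|%N].
have codeE f j : (code f j : nat)%:Z = val f j + B%:Z.
  have := valB f j; rewrite ffunE ler_norml => /andP[h1 h2].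
  have h0 : 0 <= val f j + B%:Z by lia.
  by rewrite inordK ?gez0_abs // ltnS; lia.
have /injectivePn[f [g fg efg]] : ~~ injectiveb code.
  apply/negP => /injectiveP/leq_card; rewrite !card_ffun !card_ord leqNgt => /negP[].
  apply: (@leq_ltn_trans ((2 * #|I| * a * H.+1) ^ #|J|)).
    have [->|J_gt0] := posnP #|J|; first by rewrite !expn0.
    have I_gt0 : (0 < #|I|)%N by apply: leq_ltn_trans ltJI.
    rewrite leq_exp2r // mulnS /B.
    have : (0 < 2 * #|I| * a)%N by rewrite !muln_gt0 I_gt0.
    by lia.
  rewrite expnMn -/H; apply: (@leq_trans (H.+1 * H.+1 ^ #|J|)).
    by rewrite ltn_mul2r expn_gt0 ltnSn.
  by rewrite -expnS leq_pexp2l.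
exists (fun i => (f i)%:Z - (g i)%:Z); split.
- have [i fgi] : exists i, f i != g i.
    apply/existsP; apply: contraNT fg => /existsPn h; apply/eqP/ffunP => i.
    by apply/eqP; rewrite -[_ == _]negbK.
  by exists i; rewrite subr_eq0 eqz_nat.
- by move=> i; have := ltn_ord (f i); have := ltn_ord (g i); lia.
move=> j; under eq_bigr do rewrite mulrBr.
rewrite sumrB -/(val f j) -/(val g j); apply/eqP; rewrite subr_eq0.
by rewrite -(inj_eq (addIr B%:Z)) -!codeE efg.
Qed.

(** * Rational truncations of T_p *)

(** Relates two truncations of one power series with non-negative coefficients: the first clause
    makes values at real points increase with the order and survives products thanks to
    non-negativity, the second says which coefficients are already final. *)
Definition coef_le (m : nat) (f g : {poly rat}) :=
  (forall i, 0 <= f`_i <= g`_i) /\ (forall i, (i <= m)%N -> f`_i = g`_i).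

Section CoefLe.
Variable m : nat.
Implicit Types f g : {poly rat}.

Lemma coef_le_refl f : (forall i, 0 <= f`_i) -> coef_le m f f.
Proof. by move=> f0; split=> // i; rewrite f0 lexx. Qed.

Lemma coef_le_Xn n : coef_le m 'X^n 'X^n.
Proof. by apply: coef_le_refl => i; rewrite coefXn ler0n. Qed.

Lemma coef_leD f1 f2 g1 g2 :
  coef_le m f1 g1 -> coef_le m f2 g2 -> coef_le m (f1 + f2) (g1 + g2).
Proof.
move=> [h1 e1] [h2 e2]; split=> i => [|le_im]; rewrite !coefD; last by rewrite e1 ?e2.
by have /andP[? ?] := h1 i; have /andP[? ?] := h2 i; rewrite addr_ge0 ?lerD.
Qed.

Lemma coef_le_sum (I : Type) (r : seq I) (P : pred I) (f g : I -> {poly rat}) :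
  (forall i, P i -> coef_le m (f i) (g i)) ->
  coef_le m (\sum_(i <- r | P i) f i) (\sum_(i <- r | P i) g i).
Proof.
move=> h; elim/big_rec2: _ => [|i g' f' Pi hgf]; last exact: coef_leD (h i Pi) hgf.
by apply: coef_le_refl => i; rewrite coef0.
Qed.

Lemma coef_leM f1 f2 g1 g2 :
  coef_le m f1 g1 -> coef_le m f2 g2 -> coef_le m (f1 * f2) (g1 * g2).
Proof.
move=> [h1 e1] [h2 e2]; split=> i => [|le_im]; rewrite !coefM.
  rewrite sumr_ge0 /=.
    apply: ler_sum => j _.
    by have /andP[? ?] := h1 j; have /andP[? ?] := h2 (i - j)%N; rewrite ler_pM.
  move=> j _.
  by have /andP[? ?] := h1 j; have /andP[? ?] := h2 (i - j)%N; rewrite mulr_ge0.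
apply: eq_bigr => j _; have := ltn_ord j; rewrite ltnS => le_ji.
by rewrite e1 ?e2 // (leq_trans _ le_im) ?leq_subr.
Qed.

Lemma coef_leX f g n : coef_le m f g -> coef_le m (f ^+ n) (g ^+ n).
Proof.
move=> h; elim: n => [|n IH]; last by rewrite !exprS; apply: coef_leM.
exact: coef_le_Xn 0.
Qed.

Lemma coef_leZ c f g : 0 <= c -> coef_le m f g -> coef_le m (c *: f) (c *: g).
Proof.
move=> c0 [h e]; split=> i => [|le_im]; rewrite !coefZ; last by rewrite e.
by have /andP[? ?] := h i; rewrite mulr_ge0 ?ler_wpM2l.
Qed.

Lemma coef_le_mono c n : 0 <= c -> (m < n)%N -> coef_le m 0 (c *: 'X^n).
Proof.
move=> c0 ltmn; split=> i => [|le_im]; rewrite coef0 coefZ coefXn.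
  by rewrite lexx mulr_ge0 ?ler0n.
by rewrite (ltn_eqF (leq_ltn_trans le_im ltmn)) mulr0.
Qed.

End CoefLe.

Lemma coef_le_trans m1 m2 f g h : (m1 <= m2)%N ->
  coef_le m1 f g -> coef_le m2 g h -> coef_le m1 f h.
Proof.
move=> le12 [h1 e1] [h2 e2]; split=> i => [|le_i]; last by rewrite e1 // e2 ?(leq_trans le_i).
by have /andP[f0 fg] := h1 i; have /andP[_ gh] := h2 i; rewrite f0 (le_trans fg).
Qed.

Section Tau.
Variable p : nat.
Hypothesis p_gt1 : (1 < p)%N.

(** [log T_p] is the sum over all [j, n >= 1] of [z ^ (n p ^ j) / (n p ^ j)].  Both indices are cut at
    [m], not the degree: only the coefficients of index at most [m] have their final value. *)
Definition logT (m : nat) : {poly rat} := \sum_(j < m) \sum_(n < m)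
  ((p ^ j.+1 * n.+1)%:R)^-1 *: 'X^(n.+1 * p ^ j.+1).

Definition truncT (m : nat) : {poly rat} :=
  \sum_(k < m.+1) (k`!%:R)^-1 *: logT m ^+ k.

Let pX_gt0 j : (0 < p ^ j)%N.
Proof. by rewrite expn_gt0 (ltnW p_gt1). Qed.

(** The added terms have exponent n p^j with n = m + 1 or j = m + 1, and either makes it exceed
    m. *)
Lemma logT_le m : coef_le m (logT m) (logT m.+1).
Proof.
have term_ge0 j n : 0 <= ((p ^ j.+1 * n.+1)%:R)^-1 :> rat by rewrite invr_ge0 ler0n.
rewrite /logT big_ord_recr /= -[X in coef_le _ X _]addr0; apply: coef_leD.
  apply: coef_le_sum => j _; rewrite big_ord_recr /= -[X in coef_le _ X _]addr0.
  apply: coef_leD; last by apply: coef_le_mono; rewrite // leq_pmulr.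
  by apply: coef_le_sum => n _; apply: coef_leZ (coef_le_Xn _ _).
set X := (X in coef_le _ _ X).
suff : coef_le m (\sum_(n < m.+1) 0) X by rewrite big1.
apply: coef_le_sum => n _; apply: coef_le_mono => //.
by apply: leq_trans (leq_pmull _ _) => //; apply: ltnW; apply: ltn_expl.
Qed.

Lemma logT_ge0 m i : 0 <= (logT m)`_i.
Proof. by have [/(_ i)/andP[]] := logT_le m. Qed.

Lemma logT_coef0 m : (logT m)`_0 = 0.
Proof.
rewrite coef_sum big1 // => j _; rewrite coef_sum big1 // => n _.
by rewrite coefZ coefXn eq_sym muln_eq0 /= gtn_eqF ?mulr0.
Qed.

Lemma logT_exp_coef m k i : (i < k)%N -> (logT m ^+ k)`_i = 0.
Proof.
elim: k i => // k IH i; rewrite ltnS => le_ik; rewrite exprS coefM big1 // => -[[|j] /= lt_j] _.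
  by rewrite logT_coef0 mul0r.
by rewrite IH ?mulr0 //; lia.
Qed.

Lemma truncT_leS m : coef_le m (truncT m) (truncT m.+1).
Proof.
have fact_ge0 k : 0 <= (k`!%:R)^-1 :> rat by rewrite invr_ge0 ler0n.
rewrite /truncT [X in coef_le _ _ X]big_ord_recr /= -[X in coef_le _ X _]addr0.
apply: coef_leD.
  by apply: coef_le_sum => k _; apply: coef_leZ => //; apply: coef_leX (logT_le m).
split=> i => [|le_im]; rewrite coef0 coefZ; last by rewrite logT_exp_coef ?mulr0.
rewrite lexx mulr_ge0 //.
have h : coef_le m (logT m.+1) (logT m.+1) by apply: coef_le_refl; apply: logT_ge0.
by have [/(_ i)/andP[]] := coef_leX m.+1 h.
Qed.

Lemma truncT_ge0 m i : 0 <= (truncT m)`_i.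
Proof. by have [/(_ i)/andP[]] := truncT_leS m. Qed.

Lemma truncT_le m m' : (m <= m')%N -> coef_le m (truncT m) (truncT m').
Proof.
elim: m' => [|m' IH]; first by rewrite leqn0 => /eqP->; apply: coef_le_refl; apply: truncT_ge0.
rewrite leq_eqVlt => /orP[/eqP->|]; first by apply: coef_le_refl; apply: truncT_ge0.
by rewrite ltnS => le; apply: coef_le_trans le (IH le) (truncT_leS m').
Qed.

(** Here p^m m! clears the denominators of [logT], its m-th power those of the powers up to m, and
    the last m! the factorials of the exponential series. *)
Definition denT (m : nat) : nat := (p ^ m * m`!) ^ m * m`!.

Lemma denT_gt0 m : (0 < denT m)%N.
Proof. by rewrite /denT muln_gt0 expn_gt0 muln_gt0 pX_gt0 !fact_gt0. Qed.

Lemma div_nat_int a b : (b %| a)%N -> (a%:R / b%:R : rat) \is a Num.int.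
Proof.
have [->|b0] := posnP b; first by rewrite invr0 mulr0.
by move=> /dvdnP[c ->]; rewrite natrM mulfK ?pnatr_eq0 -?lt0n.
Qed.

Lemma denT_int m : (denT m)%:R *: truncT m \is a polyOver Num.int_num_subdef.
Proof.
have logI : (p ^ m * m`!)%:R *: logT m \is a polyOver Num.int_num_subdef.
  rewrite /logT scaler_sumr; apply: rpred_sum => j _; rewrite scaler_sumr; apply: rpred_sum => n _.
  rewrite scalerA polyOverZ ?rpredX ?polyOverX // div_nat_int // dvdn_mul //.
    by rewrite dvdn_exp2l.
  by rewrite dvdn_fact //= ltn_ord.
rewrite /truncT scaler_sumr; apply: rpred_sum => k _; have := ltn_ord k; rewrite ltnS => le_km.
rewrite scalerA /denT natrM natrX; set P := (p ^ m * m`!)%:R.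
have eP : P ^+ m = P ^+ (m - k) * P ^+ k by rewrite -exprD subnK.
have -> : P ^+ m * m`!%:R / k`!%:R *: logT m ^+ k
   = (P ^+ (m - k) * (m`!%:R / k`!%:R)) *: (P *: logT m) ^+ k.
  by rewrite exprZn scalerA; congr (_ *: _); rewrite eP; ring.
rewrite polyOverZ ?rpredX // rpredM //; first by rewrite rpredX // rpred_nat.
by apply: div_nat_int; rewrite -(bin_fact le_km) mulnCA dvdn_mulr.
Qed.

End Tau.

(** * Evaluation of rational polynomials and coefficient majorants *)

Section Evaluation.
Variable R : rcfType.
Implicit Types (f g : {poly rat}) (z : R[i]) (r : R).

Definition ev f z : R[i] := (map_poly ratr f).[z].
Definition evR f r : R := (map_poly ratr f).[r].

Lemma ev_real f r : ev f r%:C%C = (evR f r)%:C%C.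
Proof.
rewrite /ev /evR -horner_map -map_poly_comp; congr (_.[_]).
by apply: eq_map_poly => q; rewrite -(fmorph_eq_rat (real_complex R \o ratr)).
Qed.

Lemma evR_wide f r n : (size f <= n)%N -> evR f r = \sum_(i < n) ratr f`_i * r ^+ i.
Proof.
move=> le_n; rewrite /evR (@horner_coef_wide _ n) ?size_map_poly //.
by apply: eq_bigr => i _; rewrite coef_map.
Qed.

Lemma ev_wide f z n : (size f <= n)%N -> ev f z = \sum_(i < n) ratr f`_i * z ^+ i.
Proof.
move=> le_n; rewrite /ev (@horner_coef_wide _ n) ?size_map_poly //.
by apply: eq_bigr => i _; rewrite coef_map.
Qed.

(** Cauchy-type estimate; it gives bounds uniform in the truncation order, since the coefficients of
    [truncT p m] are non-negative and its values at [r] are bounded by [T r]. *)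
Lemma ev_majorant f g n z r : (forall i, `|f`_i| <= g`_i) ->
  (forall i, (i < n)%N -> f`_i = 0) -> abs z <= r ->
  abs (ev f z) * r ^+ n <= abs z ^+ n * evR g r.
Proof.
move=> fg f0 zr; set S := maxn (size f) (size g).
have r0 : 0 <= r := le_trans (abs_ge0 z) zr.
rewrite (@ev_wide _ _ S) ?leq_maxl // (@evR_wide _ _ S) ?leq_maxr // mulr_sumr.
apply: le_trans (ler_wpM2r (exprn_ge0 _ r0) (abs_sum _ _ _)) _.
rewrite mulr_suml; apply: ler_sum => i _; rewrite absM absX abs_ratr.
have [lt_in|le_ni] := ltnP i n.
  rewrite f0 // normr0 rmorph0 !mul0r mulr_ge0 ?exprn_ge0 ?abs_ge0 // mulr_ge0 ?exprn_ge0 //.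
  by rewrite ler0q (le_trans _ (fg i)).
have gi : ratr `|f`_i| <= ratr g`_i :> R by rewrite ler_rat.
have split_exp (s : R) : s ^+ i = s ^+ (i - n) * s ^+ n by rewrite -exprD subnK.
rewrite !split_exp.
have -> : abs z ^+ n * (ratr g`_i * (r ^+ (i - n) * r ^+ n)) =
    ratr g`_i * r ^+ (i - n) * abs z ^+ n * r ^+ n by ring.
rewrite !mulrA.
rewrite !ler_wpM2r ?exprn_ge0 ?abs_ge0 // ler_pM ?ler0q ?exprn_ge0 ?abs_ge0 //.
by rewrite lerXn2r ?nnegrE ?abs_ge0.
Qed.

Lemma evR_le f g r : (forall i, f`_i <= g`_i) -> 0 <= r -> evR f r <= evR g r.
Proof.
move=> fg r0; set S := maxn (size f) (size g).
rewrite (@evR_wide _ _ S) ?leq_maxl // (@evR_wide _ _ S) ?leq_maxr //.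
by apply: ler_sum => i _; rewrite ler_wpM2r ?exprn_ge0 // ler_rat.
Qed.

Lemma evR_ge_coef f r i : (forall i, 0 <= f`_i) -> 0 <= r -> ratr f`_i * r ^+ i <= evR f r.
Proof.
move=> f0 r0; rewrite (@evR_wide _ _ (size f + i.+1)) ?leq_addr //.
have lt_i : (i < size f + i.+1)%N by rewrite addnS ltnS leq_addl.
rewrite (bigD1 (Ordinal lt_i)) //= lerDl sumr_ge0 // => j _.
by rewrite mulr_ge0 ?exprn_ge0 // ler0q.
Qed.

End Evaluation.

(** * Limits of complex sequences *)

Lemma bernoulli (R : realType) (a : R) m : 0 <= a -> 1 + m%:R * a <= (1 + a) ^+ m.
Proof.
move=> a0; elim: m => [|m IH]; first by rewrite mul0r addr0.
rewrite exprS; apply: le_trans (ler_wpM2l _ IH); last by rewrite addr_ge0.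
have : 0 <= m%:R * a * a by rewrite !mulr_ge0.
by rewrite -natr1; lra.
Qed.

Lemma expn_unbounded (R : realType) (a B : R) : 1 < a -> exists m, B < a ^+ m.
Proof.
move=> a1; have h : 0 < a - 1 by rewrite subr_gt0.
exists (Num.bound (`|B| / (a - 1))).
have /archi_boundP : 0 <= `|B| / (a - 1) by rewrite divr_ge0 // ltW.
rewrite ltr_pdivrMr // => lt; apply: le_lt_trans (ler_norm B) _; apply: lt_le_trans lt _.
have := bernoulli (Num.bound (`|B| / (a - 1))) (ltW h).
have -> : 1 + (a - 1) = a by ring.
by apply: le_trans; rewrite lerDr.
Qed.

Section Cvg.
Variable R : realType.
Implicit Types (u v : nat -> R[i]) (l : R[i]).

Definition cvgs u l :=
  forall e : R, 0 < e -> exists m0, forall m, (m0 <= m)%N -> abs (u m - l) < e.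

Lemma cvgs_cst l : cvgs (fun=> l) l.
Proof. by move=> e e0; exists 0 => m _; rewrite subrr abs0. Qed.

Lemma eq_cvgs u v l : (forall m, u m = v m) -> cvgs u l -> cvgs v l.
Proof. by move=> uv h e /h[m0 h0]; exists m0 => m /h0; rewrite uv. Qed.

Lemma cvgsD u v l1 l2 : cvgs u l1 -> cvgs v l2 -> cvgs (fun m => u m + v m) (l1 + l2).
Proof.
move=> hu hv e e0; have e2 : 0 < e / 2 by lra.
have [m1 h1] := hu _ e2; have [m2 h2] := hv _ e2.
exists (m1 + m2)%N => m le_m.
have {}h1 := h1 m (leq_trans (leq_addr _ _) le_m).
have {}h2 := h2 m (leq_trans (leq_addl _ _) le_m).
have -> : u m + v m - (l1 + l2) = (u m - l1) + (v m - l2) by ring.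
by have := absD (u m - l1) (v m - l2); lra.
Qed.

Lemma cvgsM u v l1 l2 : cvgs u l1 -> cvgs v l2 -> cvgs (fun m => u m * v m) (l1 * l2).
Proof.
move=> hu hv e e0; pose K := abs l1 + abs l2 + 1.
have a1 := abs_ge0 l1; have a2 := abs_ge0 l2.
have K0 : 0 < K by rewrite /K; lra.
have d0 : 0 < Num.min 1 (e / (2 * K)).
  by rewrite lt_min ltr01 divr_gt0 // mulr_gt0.
have [m1 h1] := hu _ d0; have [m2 h2] := hv _ d0.
exists (m1 + m2)%N => m le_m.
have := h1 m (leq_trans (leq_addr _ _) le_m); rewrite lt_min => /andP[_ {}h1].
have := h2 m (leq_trans (leq_addl _ _) le_m); rewrite lt_min => /andP[h21 {}h2].
have -> : u m * v m - l1 * l2 = (u m - l1) * v m + l1 * (v m - l2) by ring.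
apply: le_lt_trans (absD _ _) _; rewrite !absM.
have vK : abs (v m) <= K.
  have -> : v m = (v m - l2) + l2 by ring.
  by apply: le_trans (absD _ _) _; rewrite /K; lra.
have lK : abs l1 <= K by rewrite /K; lra.
rewrite !ltr_pdivlMr ?mulr_gt0 // in h1 h2.
have p1 := ler_wpM2l (abs_ge0 (u m - l1)) vK.
have p2 := ler_wpM2r (abs_ge0 (v m - l2)) lK.
by lra.
Qed.

Lemma cvgsX u l n : cvgs u l -> cvgs (fun m => u m ^+ n) (l ^+ n).
Proof.
move=> h; elim: n => [|n IH]; first by exact: cvgs_cst.
rewrite exprS; apply: eq_cvgs (cvgsM h IH) => m; by rewrite exprS.
Qed.

Lemma cvgs_sum n (u : 'I_n -> nat -> R[i]) (l : 'I_n -> R[i]) :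
  (forall i, cvgs (u i) (l i)) -> cvgs (fun m => \sum_i u i m) (\sum_i l i).
Proof.
elim: n u l => [|n IH] u l h.
  by rewrite big_ord0; apply: eq_cvgs (cvgs_cst 0) => m; rewrite big_ord0.
rewrite big_ord_recl; apply: eq_cvgs (cvgsD (h ord0) (IH _ _ (fun i => h (lift ord0 i)))).
by move=> m; rewrite big_ord_recl.
Qed.

Lemma cvgs_abs_le u l B m0 : cvgs u l -> (forall m, (m0 <= m)%N -> abs (u m) <= B) -> abs l <= B.
Proof.
move=> h hB; rewrite leNgt; apply/negP => ltB.
have e0 : 0 < abs l - B by rewrite subr_gt0.
have [m1 /(_ (m0 + m1)%N (leq_addl _ _)) h1] := h _ e0.
have := hB _ (leq_addr m1 m0); rewrite abs_distC in h1.
have : abs l <= abs (l - u (m0 + m1)%N) + abs (u (m0 + m1)%N).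
  by rewrite -{1}[l](subrK (u (m0 + m1)%N)) absD.
by lra.
Qed.

Lemma cvgs_eq0 l (B q : R) : 0 <= q < 1 -> (forall m, abs l <= B * q ^+ m) -> l = 0.
Proof.
move=> /andP[q0 q1] h; apply/eqP; rewrite -abs_eq0 eq_le abs_ge0 andbT leNgt.
apply/negP => l0; have [qe|q0'] := eqVneq q 0.
  by have := h 1%N; rewrite qe expr1 mulr0 leNgt l0.
have {}q0 : 0 < q by rewrite lt_def q0' q0.
have [m hm] := expn_unbounded (B / abs l) (etrans (invf_gt1 q0) q1).
move: hm; rewrite ltr_pdivrMr // exprVn mulrC ltr_pdivlMr ?exprn_gt0 //.
by rewrite ltNge h.
Qed.

End Cvg.

(** * Vanishing order of polynomials in z and T_p *)

Section Comb.
Variables (p M N : nat).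
Hypothesis p_gt1 : (1 < p)%N.
Implicit Types x : 'I_M.+1 -> 'I_N.+1 -> int.

Definition comb x m : {poly rat} :=
  \sum_i \sum_j (x i j)%:~R *: ('X^i * truncT p m ^+ j).

Let mono_le m m' (i j : nat) : (m <= m')%N ->
  coef_le m ('X^i * truncT p m ^+ j) ('X^i * truncT p m' ^+ j).
Proof. by move=> le; apply: coef_leM (coef_le_Xn _ _) (coef_leX _ (truncT_le p_gt1 le)). Qed.

Lemma comb_coef x m n : (comb x m)`_n =
  \sum_i \sum_j (x i j)%:~R * ('X^i * truncT p m ^+ j)`_n.
Proof.
rewrite coef_sum; apply: eq_bigr => i _; rewrite coef_sum; apply: eq_bigr => j _.
by rewrite coefZ.
Qed.

Lemma comb_coef_stable x m m' n : (n <= m <= m')%N -> (comb x m)`_n = (comb x m')`_n.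
Proof.
move=> /andP[le_nm le_mm]; rewrite !comb_coef; apply: eq_bigr => i _; apply: eq_bigr => j _.
by have [_ ->] := mono_le i j le_mm.
Qed.

Definition absc x i j : int := `|x i j|.

Lemma comb_abs x m n : `|(comb x m)`_n| <= (comb (absc x) m)`_n.
Proof.
rewrite !comb_coef; apply: le_trans (ler_norm_sum _ _ _) _; apply: ler_sum => i _.
apply: le_trans (ler_norm_sum _ _ _) _; apply: ler_sum => j _.
have [/(_ n)/andP[c0 _] _] := mono_le i j (leqnn m).
by rewrite normrM (ger0_norm c0) ler_wpM2r // intr_norm.
Qed.

Lemma ev_comb (R : rcfType) x m (z : R[i]) :
  ev (comb x m) z = eval2 x z (ev (truncT p m) z).
Proof.
rewrite /ev raddf_sum horner_sum; apply: eq_bigr => i _.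
rewrite raddf_sum horner_sum; apply: eq_bigr => j _.
rewrite /= map_polyZ hornerZ rmorphM /= map_polyXn rmorphXn /= hornerM hornerXn horner_exp.
by rewrite ratr_int.
Qed.

Lemma evR_comb_le (R : rcfType) x m H (r t : R) :
  (forall i j, `|x i j|%N <= H)%N -> 0 <= r <= 1 -> 1 <= t ->
  evR (truncT p m) r <= t ->
  evR (comb (absc x) m) r <= (M.+1 * N.+1 * H)%:R * t ^+ N.
Proof.
move=> hH /andP[r0 r1] t1 ht.
have ev0 : 0 <= evR (truncT p m) r.
  by apply: le_trans (evR_ge_coef 0 (truncT_ge0 p_gt1 m) r0); rewrite expr0 mulr1 ler0q truncT_ge0.
have -> : (M.+1 * N.+1 * H)%:R * t ^+ N =
    \sum_(i < M.+1) \sum_(j < N.+1) H%:R * t ^+ N.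
  by rewrite !sumr_const !card_ord -mulrnA -[RHS]mulr_natl !natrM; ring.
rewrite /evR raddf_sum horner_sum; apply: ler_sum => i _.
rewrite raddf_sum horner_sum; apply: ler_sum => j _.
rewrite /= map_polyZ hornerZ rmorphM /= map_polyXn rmorphXn /= hornerM hornerXn horner_exp.
rewrite ratr_int -/(evR _ _) ler_pM ?mulr_ge0 ?exprn_ge0 ?ler0z //.
  by rewrite /absc -abszE ler_nat.
rewrite -[X in _ <= X]mul1r ler_pM ?exprn_ge0 ?exprn_ile1 //.
apply: le_trans (_ : t ^+ j <= _); first by rewrite lerXn2r ?nnegrE // (le_trans _ t1).
by rewrite ler_weXn2l // -ltnS.
Qed.

End Comb.

(** * Analytic consequences of the order of vanishing *)

Section Order.
Variables (R : realType) (p : nat) (T : R[i] -> R[i]).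
Hypothesis p_gt1 : (1 < p)%N.
Hypothesis T_cvg : forall z, abs z < 1 -> cvgs (fun m => ev (truncT p m) z) (T z).

(** At a real point the truncations increase with [m], so none exceeds the limit; [T] is only known
    as a complex limit, hence the modulus. *)
Lemma truncT_le_T (r : R) m : 0 <= r < 1 -> evR (truncT p m) r <= abs (T r%:C%C).
Proof.
move=> /andP[r0 r1]; rewrite leNgt; apply/negP => lt.
have e0 : 0 < evR (truncT p m) r - abs (T r%:C%C) by rewrite subr_gt0.
have /T_cvg/(_ _ e0)[m0 /(_ (m + m0)%N (leq_addl _ _))] : abs r%:C%C < 1.
  by rewrite abs_real ger0_norm.
rewrite ev_real; set y := evR _ _ => h.
have [tau_le _] := truncT_le p_gt1 (leq_addr m0 m).
have le_y : evR (truncT p m) r <= y.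
  by apply: evR_le => // i; have /andP[] := tau_le i.
have : y <= abs (y%:C%C : R[i]) by rewrite abs_real ler_norm.
have : abs (y%:C%C : R[i]) <= abs (y%:C%C - T r%:C%C) + abs (T r%:C%C).
  by rewrite -{1}[y%:C%C](subrK (T r%:C%C)) absD.
by move: h le_y; set w := abs (_ - _); lra.
Qed.

Lemma truncT_ge1 (r : R) m : 0 <= r -> 1 <= evR (truncT p m) r.
Proof.
move=> r0; apply: le_trans (evR_ge_coef 0 (truncT_ge0 p_gt1 m) r0).
have [_ <- //] := truncT_le p_gt1 (leq0n m).
by rewrite expr0 mulr1 /truncT big_ord1 fact0 invr1 scale1r expr0 coef1 rmorph1.
Qed.

Lemma T_ge1 (r : R) : 0 <= r < 1 -> 1 <= abs (T r%:C%C).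
Proof.
by move=> hr; apply: le_trans (truncT_le_T 0 hr); have /andP[/truncT_ge1] := hr.
Qed.

Section Eval.
Variables (M N H : nat) (x : 'I_M.+1 -> 'I_N.+1 -> int).
Hypothesis x_le : forall i j, (`|x i j| <= H)%N.

Lemma eval2_cvg z : abs z < 1 ->
  cvgs (fun m => eval2 x z (ev (truncT p m) z)) (eval2 x z (T z)).
Proof.
move=> /T_cvg h; apply: cvgs_sum => i; apply: cvgs_sum => j.
by apply: cvgsM (cvgs_cst _) _; apply: cvgsM (cvgs_cst _) (cvgsX _ h).
Qed.

Definition bound (r : R) := (M.+1 * N.+1 * H)%:R * abs (T r%:C%C) ^+ N.

Lemma maj_le r m : 0 <= r < 1 -> evR (comb p (absc x) m) r <= bound r.
Proof.
move=> /[dup] hr /andP[r0 /ltW r1].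
by apply: evR_comb_le; rewrite ?r0 ?T_ge1 ?truncT_le_T.
Qed.

(** A Schwarz lemma: order n at 0 gives the factor (|z| / r)^n. It is proved for the truncations
    with m >= n, whose coefficients below n do vanish, and passed to the limit. *)
Lemma order_upper n z r : abs z <= r -> 0 < r < 1 ->
  (forall i, (i < n)%N -> (comb p x i)`_i = 0) ->
  abs (eval2 x z (T z)) * r ^+ n <= abs z ^+ n * bound r.
Proof.
move=> zr /andP[r0 r1] h0; rewrite -ler_pdivlMr ?exprn_gt0 //.
have z1 : abs z < 1 := le_lt_trans zr r1.
apply: (cvgs_abs_le (m0 := n) (eval2_cvg z1)) => m le_nm.
rewrite ler_pdivlMr ?exprn_gt0 // -ev_comb.
apply: le_trans (ev_majorant (comb_abs p_gt1 x m) _ zr) _.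
  move=> i lt_in; rewrite -(comb_coef_stable p_gt1 x (m := i)) ?h0 // leqnn /=.
  by rewrite ltnW // (leq_trans lt_in).
by rewrite ler_wpM2l ?exprn_ge0 ?abs_ge0 // maj_le // ltW.
Qed.

(** The same estimate once the term of degree n is removed; for small z that term then dominates,
    which is how non-vanishing is detected. *)
Lemma order_lead n z r : abs z <= r -> 0 < r < 1 ->
  (forall i, (i < n)%N -> (comb p x i)`_i = 0) ->
  abs (eval2 x z (T z) - ratr (comb p x n)`_n * z ^+ n) * r ^+ n.+1 <=
  abs z ^+ n.+1 * bound r.
Proof.
move=> zr /andP[r0 r1] h0; rewrite -ler_pdivlMr ?exprn_gt0 //.
have z1 : abs z < 1 := le_lt_trans zr r1.
set c := (comb p x n)`_n.
have cv : cvgs (fun m => eval2 x z (ev (truncT p m) z) + (- (ratr c * z ^+ n)))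
  (eval2 x z (T z) - ratr c * z ^+ n) by apply: cvgsD (eval2_cvg z1) (cvgs_cst _).
apply: (cvgs_abs_le (m0 := n) cv) => m le_nm.
rewrite ler_pdivlMr ?exprn_gt0 // -ev_comb.
have -> : ev (comb p x m) z - ratr c * z ^+ n = ev (comb p x m - c *: 'X^n) z.
  by rewrite /ev rmorphB /= map_polyZ /= map_polyXn hornerD hornerN hornerZ hornerXn.
have cm : (comb p x m)`_n = c.
  by rewrite -(comb_coef_stable p_gt1 x (m := n)) // leqnn.
apply: le_trans (ev_majorant (g := comb p (absc x) m) _ _ zr) _ => [i|i|].
- rewrite coefB coefZ coefXn; have [->|_] := eqVneq i n.
    by rewrite mulr1 cm subrr normr0 (le_trans _ (comb_abs p_gt1 x m n)).
  by rewrite mulr0 subr0 comb_abs.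
- rewrite ltnS leq_eqVlt coefB coefZ coefXn => /orP[/eqP->|lt_in].
    by rewrite eqxx mulr1 cm subrr.
  rewrite (ltn_eqF lt_in) mulr0 subr0 -(comb_coef_stable p_gt1 x (m := i)) ?h0 // leqnn /=.
  by rewrite ltnW // (leq_trans lt_in).
- by rewrite ler_wpM2l ?exprn_ge0 ?abs_ge0 // maj_le // ltW.
Qed.

(** With r strictly between |z| and 1, [order_upper] holds for every n and (|z| / r)^n tends to
    0. *)
Lemma eval2_vanish : (forall i, (comb p x i)`_i = 0) ->
  forall z, abs z < 1 -> eval2 x z (T z) = 0.
Proof.
move=> h0 z z1; pose r := (1 + abs z) / 2; have z0 := abs_ge0 z.
have r01 : 0 < r < 1 by rewrite /r; apply/andP; split; lra.
have zr : abs z < r by rewrite /r; lra.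
have /andP[r0 r1] := r01.
apply: (@cvgs_eq0 _ _ (bound r) (abs z / r)).
  by rewrite divr_ge0 ?(ltW r0) //= ltr_pdivrMr // mul1r.
move=> n; have -> : bound r * (abs z / r) ^+ n = abs z ^+ n * bound r / r ^+ n.
  by rewrite expr_div_n; ring.
rewrite ler_pdivlMr ?exprn_gt0 //; apply: (order_upper (ltW zr) r01) => i _.
exact: h0.
Qed.

End Eval.
End Order.

(** * T_p is a transcendental function *)

Section Transcendence.
Variables (R : realType) (p : nat) (T : R[i] -> R[i]).
Hypothesis p_gt1 : (1 < p)%N.
Hypothesis T_cvg : forall z, abs z < 1 -> cvgs (fun m => ev (truncT p m) z) (T z).
Hypothesis T_mahler : forall z, abs z < 1 -> T (z ^+ p) = (1 - z ^+ p) * T z ^+ p.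

Let pX_gt0 j : (0 < p ^ j)%N.
Proof. by rewrite expn_gt0 (ltnW p_gt1). Qed.

Lemma abs_exp_lt1 (z : R[i]) n : (0 < n)%N -> abs z < 1 -> abs (z ^+ n) < 1.
Proof. by move=> n0 z1; rewrite absX exprn_ilt1 ?abs_ge0 // -lt0n. Qed.

Lemma T_iter k z : abs z < 1 -> T (z ^+ (p ^ k)) = mahler_iter p k z (T z).
Proof.
move=> z1; elim: k => [|k IH]; first by rewrite /mahler_iter big_ord0 mulr1.
rewrite expnSr exprM T_mahler ?abs_exp_lt1 // IH /mahler_iter exprMn -exprM -expnSr.
rewrite big_ord_recr /= subnn expn0 expr1 -prodrXl -exprM -expnSr mulrCA; congr (_ * _).
rewrite mulrC; congr (_ * _); apply: eq_bigr => j _.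
by rewrite -exprM -expnSr subSS subnSK.
Qed.

Lemma root_of_unity_abs (zeta : R[i]) q : (0 < q)%N -> zeta ^+ q = 1 -> abs zeta = 1.
Proof.
move=> q0 z1; apply/eqP; rewrite -(pexpr_eq1 q0) ?abs_ge0 //.
by rewrite -absX z1 abs1.
Qed.

(** For z = (1 - s) zeta the power z^q is real in [0, 1), so |T(z^q)| >= 1. In the iterated
    functional equation the last factor 1 - z^q is at most q s and all others are bounded, so
    |T(z)|^q must be at least of order 1 / s. *)
Lemma radial_growth (zeta : R[i]) m : zeta ^+ (p ^ m.+1) = 1 ->
  exists2 C : R, 0 < C & forall s : R, 0 < s < 1 ->
    1 <= C * s * abs (T ((1 - s)%:C%C * zeta)) ^+ (p ^ m.+1).
Proof.
move=> zeta1; set q := (p ^ m.+1)%N.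
have zeta_abs := root_of_unity_abs (pX_gt0 m.+1) zeta1.
pose K : R := \prod_(j < m) 2 ^+ (p ^ (m.+1 - j.+1)).
have K0 : 0 < K by rewrite /K; apply: prodr_gt0 => j _; rewrite exprn_gt0.
exists (K * q%:R); first by rewrite mulr_gt0 // ltr0n pX_gt0.
move=> s /andP[s0 s1]; set z : R[i] := _ * zeta.
have r0 : 0 <= 1 - s by lra.
have abs_z : abs z = 1 - s by rewrite absM abs_real zeta_abs mulr1 ger0_norm.
have z1 : abs z < 1 by rewrite abs_z; lra.
have zq : z ^+ q = ((1 - s) ^+ q)%:C%C by rewrite exprMn zeta1 mulr1 rmorphXn.
have rq : 0 <= (1 - s) ^+ q < 1.
  have r1 : 1 - s < 1 by lra.
  by rewrite exprn_ge0 //= exprn_ilt1 // -lt0n pX_gt0.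
have := T_iter m.+1 z1; rewrite -/q zq => eT.
have := T_ge1 p_gt1 T_cvg rq; rewrite eT /mahler_iter absM absX abs_prod.
rewrite big_ord_recr /= subnn expn0 expr1 => h; apply: le_trans h _.
rewrite [X in _ <= X]mulrC ler_wpM2l ?exprn_ge0 ?abs_ge0 // -mulrA.
apply: ler_pM; rewrite ?abs_ge0 ?prodr_ge0 //.
- by move=> j _; apply: abs_ge0.
- apply: ler_prod => j _; rewrite abs_ge0 absX lerXn2r ?nnegrE ?abs_ge0 //=.
  apply: le_trans (absB _ _) _; rewrite abs1 absX abs_z.
  by rewrite lerD2l exprn_ile1 //; lra.
rewrite -/q zq -[1%R]/((1 : R)%:C%C) -rmorphB abs_real ger0_norm; last first.
  by have /andP[_ /ltW] := rq; rewrite subr_ge0.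
have : forall n, 1 - (1 - s) ^+ n <= n%:R * s; last exact.
elim=> [|n IH]; first by rewrite expr0 subrr mul0r.
rewrite exprS -natr1.
have : (1 - s) ^+ n <= 1 by rewrite exprn_ile1 //; lra.
by move=> h'; have := ler_wpM2l (ltW s0) h'; lra.
Qed.

Lemma cvgs_geometric (l : R[i]) : cvgs (fun n => (1 - 2^-1 ^+ n.+1)%:C%C * l) l.
Proof.
move=> e e0; have [m hm] := expn_unbounded (abs l / e) (ltr1n R 2%N).
exists m => n le_mn.
have -> : (1 - 2^-1 ^+ n.+1)%:C%C * l - l = - ((2^-1 ^+ n.+1)%:C%C * l).
  by rewrite rmorphB rmorph1 mulrBl mul1r addrAC subrr add0r.
have h2 : 0 < 2^-1 ^+ n.+1 :> R by rewrite exprn_gt0 // invr_gt0.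
rewrite absN absM abs_real gtr0_norm // exprVn mulrC ltr_pdivrMr ?exprn_gt0 //.
rewrite ltr_pdivrMr // in hm; rewrite mulrC; apply: lt_le_trans hm _.
by rewrite ler_wpM2r ?(ltW e0) // ler_weXn2l ?ler1n // leqW.
Qed.

Section Relation.
Variables (M N : nat) (x : 'I_M.+1 -> 'I_N.+1 -> int).
Hypothesis relation : forall z, abs z < 1 -> eval2 x z (T z) = 0.

Definition column j : {poly R[i]} := \sum_i (x i j)%:~R *: 'X^i.

Lemma column_coef (i : 'I_M.+1) j : (column j)`_i = (x i j)%:~R.
Proof.
rewrite coef_sum (bigD1 i) //= coefZ coefXn eqxx mulr1 big1 ?addr0 // => k ki.
by rewrite coefZ coefXn eq_sym (inj_eq val_inj) (negPf ki) mulr0.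
Qed.

Lemma eval2_column z v : eval2 x z v = \sum_j (column j).[z] * v ^+ j.
Proof.
rewrite /eval2 exchange_big; apply: eq_bigr => j _.
rewrite horner_sum mulr_suml; apply: eq_bigr => i _.
by rewrite hornerZ hornerXn mulrA.
Qed.

Lemma column_bounded j : exists2 A : R, 0 <= A & forall z, abs z < 1 -> abs (column j).[z] <= A.
Proof.
exists (\sum_i abs ((x i j)%:~R : R[i])); first by rewrite sumr_ge0 // => i _; apply: abs_ge0.
move=> z z1; rewrite horner_sum; apply: le_trans (abs_sum _ _ _) _.
apply: ler_sum => i _; rewrite hornerZ hornerXn absM absX ler_piMr ?abs_ge0 //.
by rewrite exprn_ile1 ?abs_ge0 // ltW.
Qed.

(** Divide the relation by [T z ^ (J - 1)]. *)
Lemma top_column_small (J : 'I_N.+1) : (forall j : 'I_N.+1, (J < j)%N -> column j = 0) ->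
  exists2 A : R, 0 <= A & forall z, abs z < 1 -> 1 <= abs (T z) ->
    abs (column J).[z] * abs (T z) <= A.
Proof.
move=> top; have [A Age0 hA] := fin_all_exists2 column_bounded.
exists (\sum_j A j); first by rewrite sumr_ge0.
move=> z z1 Tz1; have T0 : 0 < abs (T z) by lra.
have := relation z1; rewrite eval2_column (bigD1 J) //= => /eqP; rewrite addr_eq0 => /eqP e1.
have eJ : abs (column J).[z] * abs (T z) ^+ J <= \sum_(j < N.+1 | j != J) A j * abs (T z) ^+ J.-1.
  rewrite -absX -absM e1 absN; apply: le_trans (abs_sum _ _ _) _; apply: ler_sum => j jJ.
  have hj := hA j _ z1; rewrite absM absX.
  have [ltJj|] := ltnP J j.
    by rewrite top // horner0 abs0 mul0r mulr_ge0 ?exprn_ge0 ?abs_ge0 //.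
  rewrite leq_eqVlt (inj_eq val_inj) (negPf jJ) /= => ltjJ.
  rewrite ler_pM ?exprn_ge0 ?abs_ge0 // ler_weXn2l //.
  by rewrite -ltnS prednK // (leq_trans _ ltjJ).
rewrite -mulr_suml in eJ.
have A0 : 0 <= \sum_(j < N.+1 | j != J) A j by rewrite sumr_ge0.
have sumA : \sum_(j < N.+1 | j != J) A j <= \sum_j A j.
  by rewrite [X in _ <= X](bigD1 J) //= lerDr.
apply: le_trans sumA; have [J0|J0] := posnP J.
  have {e1}: (column J).[z] = 0.
    move: e1; rewrite J0 mulr1 => ->; rewrite big1 ?oppr0 // => j jJ.
    rewrite top ?horner0 ?mul0r // J0 lt0n.
    by apply: contraNneq jJ => j0; rewrite -val_eqE /= J0 j0.
  by move=> ->; rewrite abs0 mul0r.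
rewrite -(prednK J0) exprS mulrA in eJ.
by rewrite -(ler_pM2r (exprn_gt0 J.-1 T0)).
Qed.

(** Let c be the top coefficient in y. From |c(z)| |T(z)| <= A and 1 <= C s |T(z)|^q follows
    |c(z)|^q <= A^q C s, which tends to 0 along the radius. *)
Lemma top_column_root (J : 'I_N.+1) zeta m : (forall j : 'I_N.+1, (J < j)%N -> column j = 0) ->
  zeta ^+ (p ^ m.+1) = 1 -> root (column J) zeta.
Proof.
move=> top zeta1; set q := (p ^ m.+1)%N.
have q0 : (0 < q)%N := pX_gt0 _.
have [A A0 hA] := top_column_small top; have [C C0 hC] := radial_growth zeta1.
pose z n : R[i] := (1 - 2^-1 ^+ n.+1)%:C%C * zeta.
have cvz : cvgs z zeta := cvgs_geometric zeta.
have cvJ : cvgs (fun n => (column J).[z n] ^+ q) ((column J).[zeta] ^+ q).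
  apply: cvgsX; rewrite horner_coef.
  apply: eq_cvgs (cvgs_sum (fun i => cvgsM (cvgs_cst (column J)`_i) (cvgsX i cvz))).
  by move=> n; rewrite horner_coef.
have half : 0 <= (2^-1 : R) < 1 by rewrite invr_ge0 ler0n invf_lt1 // ltr1n.
suff h : (column J).[zeta] ^+ q = 0.
  by rewrite rootE; move/eqP: h; rewrite expf_eq0 => /andP[].
(* From index [m0] on, C s <= 1, so the growth estimate yields |T(z n)| >= 1, as [top_column_small]
   requires. *)
have [m0 hm0] := expn_unbounded C (ltr1n R 2%N).
apply: (@cvgs_eq0 _ _ (A ^+ q * C) 2^-1 half) => k.
apply: (cvgs_abs_le (m0 := m0 + k) cvJ) => n le_n; rewrite absX.
pose s : R := 2^-1 ^+ n.+1.
have s0 : 0 < s by rewrite exprn_gt0 // invr_gt0.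
have s1 : s < 1 by rewrite exprn_ilt1 //; case/andP: half.
have Cs : C * s <= 1.
  rewrite /s exprVn ler_pdivrMr ?exprn_gt0 // mul1r; apply: le_trans (ltW hm0) _.
  by rewrite ler_weXn2l ?ler1n // leqW // (leq_trans _ le_n) ?leq_addr.
have sk : s <= 2^-1 ^+ k.
  case/andP: half => h0 /ltW h1.
  by rewrite ler_wiXn2l // leqW // (leq_trans _ le_n) ?leq_addl.
have := hC s; rewrite s0 s1 => /(_ isT); rewrite -/(z n) => grow.
have zn1 : abs (z n) < 1.
  rewrite absM abs_real (root_of_unity_abs q0 zeta1) mulr1 -/s ger0_norm; lra.
have Tq1 : 1 <= abs (T (z n)) ^+ q.
  apply: le_trans grow _; rewrite ler_piMl ?exprn_ge0 ?abs_ge0 //.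
have T1 : 1 <= abs (T (z n)) by rewrite -(@ler_pXn2r _ q) ?nnegrE ?abs_ge0 // expr1n.
have := hA _ zn1 T1.
rewrite -(@ler_pXn2r _ q) ?nnegrE ?mulr_ge0 ?abs_ge0 // exprMn => hq.
have cq0 : 0 <= abs (column J).[z n] ^+ q by rewrite exprn_ge0 ?abs_ge0.
have h1 := ler_wpM2l cq0 grow; rewrite mulr1 in h1; apply: le_trans h1 _.
have Cs0 : 0 <= C * s by rewrite mulr_ge0 // ltW.
rewrite mulrCA; apply: le_trans (ler_wpM2l Cs0 hq) _.
rewrite mulrC -mulrA ler_wpM2l ?exprn_ge0 // ler_wpM2l // ltW //.
Qed.

(** A non-zero top column has degree at most M, yet it would vanish at all p^(M+1) > M roots of
    unity of order dividing p^(M+1). *)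
Lemma relation_trivial i j : x i j = 0.
Proof.
apply/eqP; apply/negPn/negP => xij.
have colj : column j != 0.
  apply: contraNneq xij => c0; have := column_coef i j.
  by rewrite c0 coef0 => /esym/eqP; rewrite intr_eq0.
have [J cJ top] : exists2 J, column J != 0 & forall k : 'I_N.+1, (J < k)%N -> column k = 0.
  case: (@arg_maxnP _ j (fun k => column k != 0) (@nat_of_ord _) colj) => J cJ maxJ.
  exists J => // k ltJk; apply/eqP; apply: contraTT ltJk => ck.
  by rewrite -leqNgt; apply: maxJ.
pose q := (p ^ M.+1)%N; have q0 : (0 < q)%N := pX_gt0 _.
have [rs] := closed_field_poly_normal ('X^q - 1 : {poly R[i]}).
rewrite (eqP (monicXnsubC 1 q0)) scale1r => ers.
have urs : uniq rs.
  by rewrite -separable_prod_XsubC -ers separable_Xn_sub_1 // pnatr_eq0 -lt0n.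
have srs : size rs = q.
  apply: succn_inj; rewrite -[RHS](size_XnsubC (1 : R[i]) q0) ers.
  by rewrite size_prod_XsubC.
have allrs : all (root (column J)) rs.
  apply/allP => zeta; rewrite -root_prod_XsubC -ers rootE !hornerE subr_eq0 => /eqP.
  exact: top_column_root top.
have := max_poly_roots cJ allrs urs; rewrite srs ltnNge => /negP[].
apply: (@leq_trans M.+1); last by apply: ltnW; apply: ltn_expl.
apply: leq_trans (size_sum _ _ _) _; apply/bigmax_leqP => k _.
by apply: leq_trans (size_scale_leq _ _) _; rewrite size_polyXn.
Qed.

End Relation.

Lemma order_exists M N H (x : 'I_M.+1 -> 'I_N.+1 -> int) :
  (forall i j, `|x i j| <= H)%N -> (exists i j, x i j != 0) ->
  exists n, (comb p x n)`_n != 0 /\ forall i, (i < n)%N -> (comb p x i)`_i = 0.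
Proof.
move=> hH [i [j xij]].
have [n hn] : exists n, (comb p x n)`_n != 0.
  apply: boolp.contrapT => nex; case/eqP: xij; apply: relation_trivial.
  apply: (eval2_vanish p_gt1 T_cvg hH) => n; apply/eqP/negPn/negP => hn.
  by apply: nex; exists n.
case: (ex_minnP (ex_intro (fun n => (comb p x n)`_n != 0) n hn)) => k hk mink.
exists k; split=> // l ltlk; apply/eqP/negPn/negP => /mink.
by rewrite leqNgt ltlk.
Qed.

End Transcendence.

(** * The auxiliary polynomial *)

Lemma leq_exp2 m : (m <= 2 ^ m)%N.
Proof. exact: ltnW (ltn_expl _ _). Qed.

Lemma fact_le m : (m`! <= m ^ m)%N.
Proof.
elim: m => // m IH; rewrite factS expnS leq_mul2l (leq_trans IH) ?orbT //.
by rewrite leq_expr.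
Qed.

Lemma fact_le_exp2 m : (m`! <= 2 ^ (m * m))%N.
Proof. by apply: leq_trans (fact_le m) _; rewrite expnM leq_expr ?leq_exp2. Qed.

Lemma denT_le p m : (0 < p)%N -> (denT p m <= 2 ^ (p * (m + 1) ^ 3))%N.
Proof.
move=> p0; apply: (@leq_trans ((2 ^ (p * m) * 2 ^ (m * m)) ^ m * 2 ^ (m * m))).
  rewrite leq_mul ?fact_le_exp2 // leq_expr // leq_mul ?fact_le_exp2 //.
  by rewrite expnM leq_expr ?leq_exp2.
rewrite -expnD -expnM -expnD leq_exp2l //.
have -> : ((m + 1) ^ 3 = m * m * m + 3 * (m * m) + 3 * m + 1)%N by rewrite !expnS; ring.
by nia.
Qed.

Lemma polynomial_below_exponential K d : (0 < d)%N ->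
  exists n0, forall n, (n0 <= n)%N -> (K * (n + 1) ^ 4 <= 2 ^ (n %/ d))%N.
Proof.
(* With k = n / d and j = k / 8, n + 1 is at most 8 d 2^j; the fourth power costs 2^(4 j), the
   constant [C] (where 2^12 = 8^4) at most 2^j, and 5 j <= k. *)
move=> d0; pose C := (K * d ^ 4 * 2 ^ 12)%N; exists (d * (8 * C))%N => n le_n.
pose k := (n %/ d)%N; pose j := (k %/ 8)%N.
have le_j : (C <= j)%N by rewrite /j leq_divRL // /k leq_divRL // mulnC [(C * 8)%N]mulnC.
have nk : (n + 1 <= d * (k + 1))%N by rewrite addn1 mulnC addn1 ltn_ceil.
have kj : (k + 1 <= 8 * (j + 1))%N by rewrite addn1 mulnC addn1 ltn_ceil.
have jj : (j + 1 <= 2 ^ j)%N by rewrite addn1 ltn_expl.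
apply: (@leq_trans (K * (d * (8 * 2 ^ j)) ^ 4)).
  rewrite leq_mul2l leq_expr ?orbT // (leq_trans nk) // leq_mul2l (leq_trans kj) ?orbT //.
  by rewrite leq_mul2l jj orbT.
have -> : (K * (d * (8 * 2 ^ j)) ^ 4 = C * 2 ^ (j * 4))%N.
  by rewrite /C !expnMn expnM -[(8 ^ 4)%N]/((2 ^ 3) ^ 4)%N -expnM !mulnA.
apply: (@leq_trans (2 ^ j * 2 ^ (j * 4))).
  by rewrite leq_mul2r (leq_trans le_j) ?leq_exp2 ?orbT.
by rewrite -expnD leq_exp2l // -/k; have := leq_trunc_div k 8; rewrite -/j; lia.
Qed.

Section Integrality.
Variables (p N : nat).
Hypothesis p_gt1 : (1 < p)%N.

Lemma monomial_int m a b n : (b <= N)%N ->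
  ((denT p m ^ N)%:R * ('X^a * truncT p m ^+ b)`_n) \is a Num.int.
Proof.
move=> bN; rewrite -coefZ.
have -> : (denT p m ^ N)%:R *: ('X^a * truncT p m ^+ b) =
    (denT p m ^ (N - b))%:R *: ('X^a * ((denT p m)%:R *: truncT p m) ^+ b).
  rewrite exprZn -scalerAr scalerA; congr (_ *: _).
  by rewrite -natrX -natrM -expnD subnK.
suff h : (denT p m ^ (N - b))%:R *: ('X^a * ((denT p m)%:R *: truncT p m) ^+ b)
    \is a polyOver Num.int_num_subdef by exact: (polyOverP h).
rewrite polyOverZ ?rpred_nat // rpredM ?rpredX ?polyOverX //.
exact: denT_int.
Qed.

(** Clearing denominators turns the leading coefficient into a non-zero integer. *)
Lemma comb_lower M (x : 'I_M.+1 -> 'I_N.+1 -> int) n : (comb p x n)`_n != 0 ->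
  1 <= (denT p n ^ N)%:R * `|(comb p x n)`_n|.
Proof.
move=> c0; have d0 : (0 < denT p n ^ N)%N by rewrite expn_gt0 denT_gt0.
rewrite -[X in X * _]ger0_norm ?ler0n // -normrM; apply: norm_intr_ge1; last first.
  by rewrite mulf_neq0 // pnatr_eq0 -lt0n.
rewrite comb_coef mulr_sumr rpred_sum // => i _; rewrite mulr_sumr rpred_sum // => j _.
by rewrite mulrCA rpredM ?intr_int // monomial_int // -ltnS.
Qed.

End Integrality.

Section Main.
Variables (R : realType) (p : nat) (T : R[i] -> R[i]).
Hypothesis p_gt1 : (1 < p)%N.
Hypothesis T_cvg : forall z, abs z < 1 -> cvgs (fun m => ev (truncT p m) z) (T z).
Hypothesis T_mahler : forall z, abs z < 1 -> T (z ^+ p) = (1 - z ^+ p) * T z ^+ p.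

Let half01 : 0 < (2^-1 : R) < 1.
Proof. by rewrite invr_gt0 ltr0n invf_lt1 // ltr1n. Qed.

(** Cauchy's bound at radius 1/2: a non-negative coefficient times 2^(-n) is at most the value
    there, which is at most T(1/2)^b. *)
Lemma monomial_coef_le t m a b N n : (abs (T (2^-1 : R)%:C%C) <= t%:R) -> (b <= N)%N ->
  ('X^a * truncT p m ^+ b)`_n <= (2 ^ n * t ^ N)%:R.
Proof.
move=> ht bN; have /andP[h0 h1] := half01.
have f0 i : 0 <= ('X^a * truncT p m ^+ b)`_i.
  have [/(_ i)/andP[]//] := coef_leM (coef_le_Xn m a) (coef_leX b (truncT_le p_gt1 (leqnn m))).
have := evR_ge_coef n f0 (ltW h0).
rewrite exprVn ler_pdivrMr ?exprn_gt0 // => h.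
have /(le_trans h) : evR ('X^a * truncT p m ^+ b) (2^-1 : R) * 2 ^+ n <= (2 ^ n * t ^ N)%:R.
  rewrite natrM mulrC natrX ler_wpM2l ?exprn_ge0 //.
  rewrite /evR rmorphM /= map_polyXn rmorphXn /= hornerM hornerXn horner_exp -/(evR _ _).
  have e0 : 0 <= evR (truncT p m) (2^-1 : R).
    by apply: le_trans (truncT_ge1 p_gt1 m (ltW h0)).
  have et : evR (truncT p m) (2^-1 : R) <= t%:R.
    by apply: le_trans ht; apply: truncT_le_T => //; rewrite (ltW h0).
  have t1 : 1 <= t%:R :> R by apply: le_trans et; apply: truncT_ge1 => //; apply: ltW.
  rewrite -[X in _ <= X]mul1r ler_pM ?exprn_ge0 ?(ltW h0) ?exprn_ile1 ?(ltW h0) ?(ltW h1) //.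
  rewrite natrX; apply: le_trans (_ : t%:R ^+ b <= _); last by rewrite ler_weXn2l.
  by rewrite lerXn2r ?nnegrE ?ler0n.
by rewrite -(ratr_nat R) ler_rat.
Qed.

(** There are M N equations for (M + 1)(N + 1) unknowns. All equations are written with the single
    truncation m = M N, which gives them a common denominator; stability of coefficients moves them
    back to the diagonal. *)
Lemma auxiliary t M N : (abs (T (2^-1 : R)%:C%C) <= t%:R) -> (0 < t)%N ->
  exists x : 'I_M.+1 -> 'I_N.+1 -> int,
  [/\ exists i j, x i j != 0,
      forall i j, (`|x i j|%N <= (2 * (M.+1 * N.+1) *
        (denT p (M * N) ^ N * (2 ^ (M * N) * t ^ N))) ^ (M * N))%N &
      forall i, (i < M * N)%N -> (comb p x i)`_i = 0].
Proof.
move=> ht t0; set m := (M * N)%N; set A := (denT p m ^ N * _)%N.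
have h (j : 'I_m) (i : 'I_M.+1 * 'I_N.+1) : exists z : int,
    z%:~R = (denT p m ^ N)%:R * ('X^(i.1) * truncT p m ^+ (i.2))`_j /\ (`|z|%N <= A)%N.
  have le2 : (i.2 <= N)%N by rewrite -ltnS.
  have /intrP[z ez] := monomial_int p m i.1 j le2.
  exists z; split=> //; rewrite -lez_nat abszE -(ler_int rat) intr_norm -ez.
  have [/(_ j)/andP[c0 _] _] := coef_leM (coef_le_Xn m i.1)
    (coef_leX i.2 (truncT_le p_gt1 (leqnn m))).
  rewrite ger0_norm ?mulr_ge0 ?ler0n // -pmulrn /A natrM ler_wpM2l ?ler0n //.
  apply: le_trans (monomial_coef_le m i.1 j ht le2) _.
  by rewrite ler_nat leq_mul2r leq_exp2l // ltnW ?orbT.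
have [Z hZ] := fin_all_exists (fun j => fin_all_exists (h j)).
have A0 : (0 < A)%N by rewrite /A !muln_gt0 !expn_gt0 denT_gt0 // t0.
have ltJI : (#|'I_m| < #|{: 'I_M.+1 * 'I_N.+1}|)%N.
  by rewrite card_prod !card_ord /m mulSn mulnS; lia.
have [x [[[a b] x0] xH xZ]] := siegel A0 ltJI (fun j i => (hZ j i).2).
exists (fun i j => x (i, j)); split; first by exists a, b.
  by move=> i j; have := xH (i, j); rewrite card_prod !card_ord.
move=> i lt_im; rewrite (comb_coef_stable p_gt1 _ (m' := m)) ?leqnn ?(ltnW lt_im) //.
have d0 : (denT p m ^ N)%:R != 0 :> rat by rewrite pnatr_eq0 -lt0n expn_gt0 denT_gt0.
apply: (mulfI d0); rewrite mulr0 comb_coef pair_bigA /= mulr_sumr.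
rewrite -[RHS](rmorph0 (intmul (1 : rat))) -(xZ (Ordinal lt_im)) rmorph_sum.
apply: eq_bigr => -[k l] _; rewrite rmorphM /= (hZ (Ordinal lt_im) (k, l)).1 /=.
by rewrite mulrCA mulrC.
Qed.

End Main.

(** * Transcendence of the values *)

(** The summands bound, in order, the exponents of the factors of [size_bound]: 2^(n+1), the power
    of (M + 1)(N + 1) H, t^N, 2^K and the denominator. *)
Definition size_exponent p N t D K :=
  (1 + (D + 1) * (N * p + t * N + 6) + t * N + K + p * N)%N.

(** One product dominating both the smallness condition of [nonvanishing] and the constants of the
    final comparison. Denominators are 2^(O(X^3)) with X = n + 1, and the power M N <= X in Siegel's
    bound makes this X^4. *)
Lemma size_bound p N t D K M n (H : nat) : (0 < p)%N -> (0 < M)%N -> (0 < N)%N ->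
  (M * N <= n)%N ->
  H = ((2 * (M.+1 * N.+1) * (denT p (M * N) ^ N * (2 ^ (M * N) * t ^ N))) ^ (M * N))%N ->
  (2 ^ n.+1 * (M.+1 * N.+1 * H) ^ D.+1 * t ^ N * 2 ^ K * denT p n ^ N
    <= 2 ^ (size_exponent p N t D K * (n + 1) ^ 4))%N.
Proof.
move=> p0 M0 N0 le_n ->; set m := (M * N)%N in le_n *.
set X := (n + 1)%N.
have X0 : (0 < X)%N by rewrite /X addn1.
have X13 : (X <= X ^ 3)%N by rewrite -{1}[X]expn1 leq_pexp2l.
have X34 : (X ^ 3 <= X ^ 4)%N by rewrite leq_pexp2l.
have X3_gt0 : (0 < X ^ 3)%N by rewrite expn_gt0 X0.
have Mm : (M <= m)%N by rewrite leq_pmulr.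
have Nm : (N <= m)%N by rewrite leq_pmull.
have nX : (n <= X)%N by rewrite /X leq_addr.
have den_le l : (l <= n)%N -> (denT p l ^ N <= 2 ^ (p * N * X ^ 3))%N.
  move=> le_l; apply: leq_trans (leq_expr N (denT_le l p0)) _; rewrite -expnM; rewrite leq_exp2l //.
  by rewrite mulnAC leq_mul2l leq_expr ?orbT // leq_add2r.
have t_le : (t ^ N <= 2 ^ (t * N))%N by rewrite expnM leq_expr ?leq_exp2.
have U_le : (M.+1 * N.+1 <= 2 ^ (2 * X))%N.
  rewrite mul2n -addnn expnD leq_mul //.
    by apply: leq_trans (leq_exp2 _) _; rewrite leq_exp2l //; lia.
  by apply: leq_trans (leq_exp2 _) _; rewrite leq_exp2l //; lia.
set A := (denT p m ^ N * _)%N.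
have A_le : (A <= 2 ^ ((p * N + 1 + t * N) * X ^ 3))%N.
  rewrite !mulnDl mul1n !expnD /A mulnA; apply: leq_mul; first apply: leq_mul.
  - exact: den_le.
  - by rewrite leq_exp2l //; lia.
  - by apply: leq_trans t_le _; rewrite leq_exp2l // leq_pmulr.
have H_le : ((2 * (M.+1 * N.+1) * A) ^ m <= 2 ^ ((N * p + t * N + 4) * X ^ 4))%N.
  apply: (@leq_trans ((2 ^ ((N * p + t * N + 4) * X ^ 3)) ^ m)).
    apply: leq_expr; apply: (@leq_trans (2 * 2 ^ (2 * X) * 2 ^ ((p * N + 1 + t * N) * X ^ 3))).
      by rewrite !leq_mul.
    by rewrite -expnS -expnD; rewrite leq_exp2l //; rewrite [(p * N)%N]mulnC !mulnDl; lia.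
  rewrite -expnM; rewrite leq_exp2l //; rewrite -mulnA leq_mul2l [(X ^ 4)%N]expnSr leq_mul2l.
  by rewrite (leq_trans le_n nX) !orbT.
set h := (_ ^ m)%N in H_le *.
have UH_le : ((M.+1 * N.+1 * h) ^ D.+1 <= 2 ^ ((D + 1) * (N * p + t * N + 6) * X ^ 4))%N.
  rewrite addn1 -[(D.+1 * _ * _)%N]mulnA [(D.+1 * _)%N]mulnC expnM; apply: leq_expr.
  apply: leq_trans (leq_mul U_le H_le) _; rewrite -expnD; rewrite leq_exp2l //.
  by rewrite !mulnDl; lia.
rewrite /size_exponent.
have t_le4 : (t ^ N <= 2 ^ (t * N * X ^ 4))%N.
  by apply: leq_trans t_le _; rewrite leq_exp2l // leq_pmulr // expn_gt0 X0.
have K_le4 : (2 ^ K <= 2 ^ (K * X ^ 4))%N by rewrite leq_exp2l // leq_pmulr // expn_gt0 X0.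
have d_le4 : (denT p n ^ N <= 2 ^ (p * N * X ^ 4))%N.
  by apply: leq_trans (den_le n (leqnn n)) _; rewrite leq_exp2l // leq_mul2l X34 orbT.
have n_le4 : (2 ^ n.+1 <= 2 ^ (X ^ 4))%N.
  by rewrite leq_exp2l // -addn1 -/X (leq_trans X13).
rewrite !(mulnDl _ _ (X ^ 4)%N) mul1n !expnD.
by do 4! apply: leq_mul => //.
Qed.

(** Expanded, the right-hand side is s M + 4 s^2 k + 4 s^2, and each of the first two terms is at
    most n / 4. *)
Lemma degree_contradiction s M k n : (n <= s * (M + 4 * s * k.+1))%N ->
  (M * (4 * s) <= n)%N -> (k * (16 * s ^ 2) <= n)%N -> (n <= 8 * s ^ 2)%N.
Proof.
have -> : (k * (16 * s ^ 2) = 16 * (s * s * k))%N by rewrite -mulnn; ring.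
have -> : (s * (M + 4 * s * k.+1) = s * M + 4 * (s * s * k) + 4 * (s * s))%N by rewrite -addn1; ring.
have -> : (M * (4 * s) = 4 * (s * M))%N by ring.
by rewrite -mulnn; lia.
Qed.

Section Main.
Variables (R : realType) (p : nat) (T : R[i] -> R[i]).
Hypothesis p_gt1 : (1 < p)%N.
Hypothesis T_cvg : forall z, abs z < 1 -> cvgs (fun m => ev (truncT p m) z) (T z).
Hypothesis T_mahler : forall z, abs z < 1 -> T (z ^+ p) = (1 - z ^+ p) * T z ^+ p.

(** If the value were 0, [order_lead] at radius 1/2 would bound the leading coefficient by a
    multiple of |z|, against its lower bound 1 / denT^N. *)
Lemma nonvanishing M N H (x : 'I_M.+1 -> 'I_N.+1 -> int) n (t : nat) (z : R[i]) :
  (forall i j, `|x i j|%N <= H)%N -> abs (T (2^-1 : R)%:C%C) <= t%:R ->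
  (comb p x n)`_n != 0 -> (forall i, (i < n)%N -> (comb p x i)`_i = 0) ->
  z != 0 -> abs z <= 2^-1 ->
  abs z * (2 ^ n.+1 * (M.+1 * N.+1 * H * t ^ N) * denT p n ^ N)%:R < 1 ->
  eval2 x z (T z) != 0.
Proof.
move=> hH ht cn c0 z0 z2; apply: contraTneq => y0.
have half01 : 0 < (2^-1 : R) < 1 by rewrite invr_gt0 ltr0n invf_lt1 // ltr1n.
have := order_lead p_gt1 T_cvg hH z2 half01 c0.
have zn : 0 < abs z ^+ n by rewrite exprn_gt0 // abs_gt0.
rewrite y0 sub0r absN absM absX abs_ratr exprVn ler_pdivrMr ?exprn_gt0 //.
set c := ratr `|_|; set B := bound _ _ _ _ _ => h.
have {h} hc : c <= abs z * B * 2 ^+ n.+1.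
  rewrite -(ler_pM2r zn); apply: le_trans h _; rewrite exprS le_eqVlt; apply/orP; left.
  by apply/eqP; ring.
have hB : B <= (M.+1 * N.+1 * H * t ^ N)%:R.
  rewrite /B /bound [X in _ <= X]natrM ler_wpM2l ?ler0n // natrX lerXn2r ?nnegrE ?abs_ge0 ?ler0n //.
have := comb_lower p_gt1 cn; rewrite -(ler_rat R) rmorph1 rmorphM /= ratr_nat -/c => h1.
rewrite -leNgt; apply: le_trans h1 _; rewrite [(_ * denT p n ^ N)%N]mulnC natrM.
clearbody c; rewrite [X in _ <= X]mulrCA ler_wpM2l ?ler0n //; apply: le_trans hc _; rewrite natrM natrX -mulrA.
by rewrite ler_wpM2l ?abs_ge0 // mulrC ler_wpM2l ?exprn_ge0.
Qed.

Theorem transcendence (alpha : R[i]) : alpha != 0 -> abs alpha < 1 ->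
  algebraicOver (ratr : rat -> R[i]) alpha ->
  ~ algebraicOver (ratr : rat -> R[i]) (T alpha).
Proof.
move=> alpha0 alpha1 alg_alpha alg_T.
have p_gt0 : (0 < p)%N := ltnW p_gt1.
have [D [E [kappa [E_gt0 kappa_gt0 lower]]]] := mahler_lower_bound p_gt0 alg_alpha alg_T.
set a := (abs alpha)^-1.
have al0 : 0 < abs alpha by rewrite abs_gt0.
have a1 : 1 < a by rewrite /a invf_gt1.
have a0 : 0 < a by apply: lt_trans a1.
have half01 : 0 < (2^-1 : R) < 1 by rewrite invr_gt0 ltr0n invf_lt1 // ltr1n.
pose t := Num.bound (abs (T (2^-1 : R)%:C%C)).
have ht : abs (T (2^-1 : R)%:C%C) <= t%:R by apply: ltW; apply: archi_boundP; apply: abs_ge0.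
have t0 : (0 < t)%N.
  rewrite -(ltr0n R); apply: lt_le_trans ht; apply: lt_le_trans ltr01 _.
  by apply: (T_ge1 p_gt1 T_cvg); case/andP: half01 => /ltW ->.
(* The factor 2^K absorbs 1 / kappa. *)
have [K hK] := expn_unbounded kappa^-1 (ltr1n R 2).
(* [s] converts Liouville's base into powers of a = 1 / |alpha|; the extra factor 2 leaves room for
   the constants of P, which will be below 2^q. *)
have [s hs] := expn_unbounded (2 * E%:R) a1.
have s0 : (0 < s)%N.
  rewrite lt0n; apply/eqP => s0; move: hs; rewrite s0 expr0 ltNge => /negP[].
  have : 1 <= E%:R :> R by rewrite ler1n.
  by lra.
(* [n <= s * (M + N * k.+1)] will follow; with these [N], [M] and [k] its right-hand side is at most
   [n / 2 + 4 * s ^ 2], while [n >= M > 8 * s ^ 2]. *)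
pose N := (4 * s)%N; pose K1 := size_exponent p N t D K.
have d0 : (0 < 16 * s ^ 2)%N by rewrite muln_gt0 expn_gt0 s0.
have [n0 hn0] := polynomial_below_exponential (s * (K1 + 1)) d0.
pose M := (n0 + 8 * s ^ 2 + 1)%N.
have M0 : (0 < M)%N by rewrite /M addn1.
have N0 : (0 < N)%N by rewrite /N muln_gt0.
have [x [x0 xH xZ]] := auxiliary p_gt1 T_cvg M N ht t0.
set H := (_ ^ (M * N))%N in xH.
have [n [cn c0]] := order_exists p_gt1 T_cvg T_mahler xH x0.
have le_n : (M * N <= n)%N by rewrite leqNgt; apply/negP => /xZ/eqP; apply/negP.
have size := @size_bound p N t D K M n H p_gt0 M0 N0 le_n erefl.
set U := (M.+1 * N.+1)%N in size.
pose k := (n %/ (16 * s ^ 2))%N; pose q := (p ^ k)%N.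
(* The [+ 1] keeps 2^L strictly above the bound of [size_bound]. As n >= M >= n0, s L <= q, hence
   2^L <= a^(s L) <= a^q = 1 / |z|: the constants of P are smaller than 1 / |z|. *)
pose L := ((K1 + 1) * (n + 1) ^ 4)%N.
have Lq : (s * L <= q)%N.
  rewrite /L mulnA; apply: leq_trans (hn0 n _) _; last by rewrite /q /k leq_expr.
  by apply: leq_trans le_n; apply: leq_trans (leq_pmulr _ N0); rewrite /M -addnA leq_addr.
pose z := alpha ^+ q.
have aq : 2 ^+ L <= a ^+ q.
  apply: (@le_trans _ _ (a ^+ (s * L))); last by rewrite ler_weXn2l // ltW.
  rewrite exprM lerXn2r ?nnegrE ?ler0n ?exprn_ge0 ?(ltW a0) //.
  apply: le_trans (ltW hs); have : 1 <= E%:R :> R by rewrite ler1n.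
  by lra.
have abs_z : abs z = (a ^+ q)^-1 by rewrite /z absX /a exprVn invrK.
have aq0 : 0 < a ^+ q by rewrite exprn_gt0.
have L1 : (0 < L)%N by rewrite muln_gt0 addn1 expn_gt0 addn1.
have H0 : (0 < U * H)%N.
  by rewrite /U muln_gt0 /= /H expn_gt0 !muln_gt0 !expn_gt0 denT_gt0 //= t0.
have z2 : abs z <= 2^-1.
  rewrite abs_z lef_pV2 ?posrE ?ltr0n //; apply: le_trans aq.
  by rewrite -[X in X <= _]expr1 ler_weXn2l // ler1n.
have z0 : z != 0 by rewrite expf_neq0.
have ltL : (K1 * (n + 1) ^ 4 < L)%N by rewrite /L mulnDl mul1n -addn1 leq_add2l expn_gt0 addn1.
have y0 : eval2 x z (T z) != 0.
  apply: (nonvanishing xH ht cn c0 z0 z2).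
  rewrite abs_z mulrC ltr_pdivrMr // mul1r; apply: lt_le_trans aq.
  rewrite -natrX ltr_nat; apply: (@leq_ltn_trans (2 ^ (K1 * (n + 1) ^ 4))); last by rewrite ltn_exp2l.
  apply: leq_trans size; rewrite leq_mul //.
  rewrite -2!(mulnA (2 ^ n.+1)%N) leq_mul //.
  rewrite -[X in (X <= _)%N]muln1 leq_mul ?expn_gt0 // leq_mul //.
  by rewrite -[X in (X <= _)%N]muln1 expnS leq_mul // expn_gt0 H0.
have upper := order_upper p_gt1 T_cvg xH z2 half01 c0.
have := lower k M N H x xH; rewrite /= -(T_iter p_gt1 T_mahler k alpha1) -/q -/z => /(_ y0).
set y := abs _ in upper *; set m := (M + N * k.+1)%N => low.
have m0 : (0 < m)%N by rewrite /m addn_gt0 M0.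
have y_le : y <= (2 ^ n * (U * H * t ^ N))%:R / (a ^+ q) ^+ n.
  rewrite exprVn ler_pdivrMr ?exprn_gt0 // in upper; apply: le_trans upper _.
  have hb : bound T M N H 2^-1 <= (U * H * t ^ N)%:R.
    rewrite /bound [X in _ <= X]natrM ler_wpM2l ?ler0n //.
    by rewrite natrX lerXn2r ?nnegrE ?abs_ge0 ?ler0n.
  rewrite abs_z exprVn natrM natrX; set v := (_ ^+ n)^-1; set b := bound _ _ _ _ _ in hb *.
  have v0 : 0 <= v by rewrite invr_ge0 exprn_ge0 ?(ltW aq0).
  have -> : v * b * 2 ^+ n = 2 ^+ n * b * v by ring.
  by rewrite ler_wpM2r // ler_wpM2l ?exprn_ge0.
have {low y_le} big : kappa * a ^+ (q * n) <=
    ((U * H) ^ D * E ^ (m * q) * (2 ^ n * (U * H * t ^ N)))%:R.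
  rewrite exprM -ler_pdivlMr ?exprn_gt0 //; apply: le_trans low _.
  by rewrite [X in _ <= X / _]natrM -[X in _ <= X]mulrA ler_wpM2l ?ler0n.
(* Everything that depends on P, and 1 / kappa as well, fits into the single factor 2^q. *)
have small : ((U * H) ^ D * (2 ^ n * (U * H * t ^ N)) * 2 ^ K <= 2 ^ q)%N.
  apply: (@leq_trans (2 ^ (K1 * (n + 1) ^ 4))); last first.
    by rewrite leq_exp2l // (leq_trans (ltnW ltL)) // (leq_trans _ Lq) // leq_pmull.
  apply: leq_trans size; rewrite -[X in (X <= _)%N]muln1 leq_mul ?expn_gt0 ?denT_gt0 //.
  have -> : ((U * H) ^ D * (2 ^ n * (U * H * t ^ N)) = 2 ^ n * (U * H) ^ D.+1 * t ^ N)%N.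
    by rewrite [((U * H) ^ D.+1)%N]expnSr; ring.
  by rewrite leq_mul // leq_mul // leq_mul // leq_exp2l.
have : a ^+ (q * n) <= (2 ^ q * E ^ (m * q))%:R.
  rewrite -(ler_pM2l kappa_gt0); apply: le_trans big _.
  have k2 : 1 <= kappa * 2 ^+ K by rewrite -ler_pdivrMl // mulr1 ltW.
  set P := ((U * H) ^ D)%N in small *; set Q := (2 ^ n * _)%N in small *.
  clearbody P Q.
  have small' : P%:R * Q%:R * 2 ^+ K <= (2 ^ q)%:R :> R by rewrite -natrX -!natrM ler_nat.
  rewrite !natrM; set e := (E ^ (m * q))%:R; have e0 : 0 <= e by apply: ler0n.
  set g := (2 ^ q)%:R in small' *; clearbody e g; rewrite [X in X <= _](_ : _ = P%:R * Q%:R * e); last by ring.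

  have PQ : 0 <= P%:R * Q%:R * e :> R by rewrite !mulr_ge0 ?ler0n.
  have h1 := ler_wpM2l PQ k2; have h2 := ler_wpM2l (mulr_ge0 (ltW kappa_gt0) e0) small'.
  by lra.
(* As m >= 1, also 2^q <= 2^(m q); then a^(q n) <= (2 E)^(m q) <= a^(s m q), and q cancels from the
   exponents. *)
have le_E : (2 ^ q * E ^ (m * q) <= (2 * E) ^ (m * q))%N.
  by rewrite expnMn leq_mul // leq_exp2l // leq_pmull.
move=> /le_trans/(_ (_ : _ <= ((2 * E) ^ (m * q))%:R)) -/(_ ltac:(by rewrite ler_nat)) h.
have : a ^+ (q * n) <= a ^+ (s * (m * q)).
  apply: le_trans h _; rewrite exprM natrX lerXn2r ?nnegrE ?ler0n ?exprn_ge0 ?(ltW a0) //.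
  by rewrite natrM; apply: ltW.
rewrite ler_eXn2l // mulnA mulnC leq_mul2r.
have -> /= : (q == 0)%N = false by rewrite /q expn_eq0 eqn0Ngt p_gt0.
have kn : (k * (16 * s ^ 2) <= n)%N := leq_trunc_div _ _.
move=> n_le; have := degree_contradiction n_le le_n kn; rewrite leqNgt => /negP[].
by apply: leq_trans le_n; apply: leq_trans (leq_pmulr _ N0); rewrite /M addn1 ltnS leq_addl.
Qed.

End Main.

(** * From Coquelicot's C to R[i] *)

Local Notation RR := (Rdefinitions.R : realType).
Local Notation CC := (RR[i]).

Definition toC (z : C) : CC := Complex (fst z) (snd z).
Definition ofC (z : CC) : C := (complex.Re z, complex.Im z).

Lemma toCK z : ofC (toC z) = z.
Proof. by case: z. Qed.

Lemma ofCK z : toC (ofC z) = z.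
Proof. by case: z. Qed.

Lemma toC_plus a b : toC (Cplus a b) = toC a + toC b.
Proof. by []. Qed.

Lemma toC_mult a b : toC (Cmult a b) = toC a * toC b.
Proof. by case: a b => a1 a2 [b1 b2]. Qed.

Lemma toC_minus a b : toC (Cminus a b) = toC a - toC b.
Proof. by []. Qed.

Lemma toC_real (x : Rdefinitions.R) : toC (RtoC x) = (x : RR)%:C%C.
Proof. by []. Qed.

Lemma toC_pow z n : toC (Cpow z n) = toC z ^+ n.
Proof. by elim: n => [//|n IH]; rewrite Cpow_S toC_mult IH exprS. Qed.

Lemma abs_toC z : abs (toC z) = Cmod z.
Proof. by case: z => x y; rewrite /abs /Cmod RsqrtE RplusE !RpowE. Qed.

Lemma toC_csum f n : toC (csum f n) = \sum_(i < n) toC (f i).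
Proof.
elim: n => [|n IH]; first by rewrite big_ord0.
by rewrite csum_S toC_plus IH big_ord_recr.
Qed.

Lemma pow_expn a n : Nat.pow a n = expn a n.
Proof. by elim: n => [//|n IH]; rewrite expnS -IH. Qed.

Lemma toC_inv_nat n : toC (RtoC (Rinv (INR n))) = (n%:R)^-1.
Proof. by rewrite toC_real INRE RinvE fmorphV rmorph_nat. Qed.

Lemma ev_logT p z m : ev (logT p m) (toC z) = toC (log_trunc p z m).
Proof.
rewrite /log_trunc toC_csum /ev raddf_sum horner_sum; apply: eq_bigr => j _.
rewrite raddf_sum horner_sum toC_mult (toC_inv_nat (Nat.pow p j.+1)) /log_sum toC_csum mulr_sumr.
apply: eq_bigr => n _; rewrite [LHS]/= map_polyZ map_polyXn hornerZ hornerXn.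
rewrite toC_mult (toC_inv_nat n.+1) !toC_pow -exprM mulrA pow_expn.
by rewrite fmorphV rmorph_nat natrM invfM mulnC.
Qed.

Lemma ev_truncT p z m : ev (truncT p m) (toC z) = toC (exp_sum (log_trunc p z m) m.+1).
Proof.
rewrite /exp_sum toC_csum /ev raddf_sum horner_sum; apply: eq_bigr => k _.
rewrite [LHS]/= map_polyZ rmorphXn [LHS]/= hornerZ horner_exp -/(ev _ _) ev_logT.
by rewrite toC_mult (toC_inv_nat (fact k)) toC_pow factE fmorphV rmorph_nat.
Qed.

Definition zint (c : Z) : int :=
  match c with Z0 => 0 | Zpos n => (Pos.to_nat n)%:Z | Zneg n => - (Pos.to_nat n)%:Z end.

Lemma toC_IZR c : toC (RtoC (IZR c)) = (zint c)%:~R.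
Proof.
rewrite toC_real; case: c => [|n|n] //=; rewrite /IZR -INR_IPR INRE.
  by rewrite rmorph_nat.
by rewrite RoppE rmorphN rmorph_nat rmorphN.
Qed.

Lemma zint_eq0 c : zint c = 0 -> c = Z0.
Proof. by case: c => [//|n|n]; have := Pos2Nat.is_pos n; rewrite /=; lia. Qed.

Definition poly_of (cs : list Z) : {poly rat} := Poly [seq (zint c)%:~R | c <- cs].

Lemma poly_of_cons c cs : poly_of (c :: cs) = poly_of cs * 'X + ((zint c)%:~R)%:P.
Proof. by rewrite /poly_of /= cons_poly_def. Qed.

Lemma poly_of_neq0 cs : (exists c, In c cs /\ c <> Z0) -> poly_of cs != 0.
Proof.
move=> [c [inc c0]]; apply/eqP; elim: cs inc => [//|a cs IH] inc e0.
have a0 : (zint a)%:~R = 0 :> rat.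
  by have := congr1 (fun f : {poly rat} => f`_0) e0; rewrite poly_of_cons coefD coefMX coefC coef0 add0r.
case: inc => [eac|inc].
  by apply: c0; rewrite -eac; apply: zint_eq0; apply/eqP; rewrite -(intr_eq0 rat) a0.
apply: IH => //; apply/eqP; move/eqP: e0.
by rewrite poly_of_cons a0 addr0 mulf_eq0 polyX_eq0 orbF.
Qed.

(** The first exponent [s] is left free for the induction on the list; [algebraic] has s = 0. *)
Lemma ev_poly_of cs z s :
  toC (fold_right Cplus (RtoC 0)
    (List.map (fun kc => Cmult (RtoC (IZR (snd kc))) (Cpow z (fst kc)))
       (List.combine (List.seq s (length cs)) cs))) = toC z ^+ s * ev (poly_of cs) (toC z).
Proof.
elim: cs s => [|c cs IH] s.
  by rewrite /ev /poly_of /= map_poly0 horner0 mulr0.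
rewrite /= toC_plus IH toC_mult toC_IZR toC_pow /ev poly_of_cons.
rewrite rmorphD rmorphM /= map_polyX map_polyC hornerMXaddC exprS /= ratr_int.
by ring.
Qed.

Lemma algebraic_toC z : algebraic z -> algebraicOver (ratr : rat -> CC) (toC z).
Proof.
move=> [cs [nz e0]]; exists (poly_of cs); first exact: poly_of_neq0.
have := ev_poly_of cs z 0; rewrite e0 expr0 mul1r => h.
by apply/rootP; rewrite -/(ev _ _) -h.
Qed.

(** [S] gives the sum on the whole disk, since the argument needs T_p as a function: at alpha, at
    alpha^q, at 1/2 and near roots of unity. *)
Lemma Tp_transcendental p (S : C -> C) alpha : (2 <= p)%N ->
  (forall z, Rlt (Cmod z) 1 -> @is_series C_AbsRing C_NormedModule (Tp_log_term p z) (S z)) ->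
  alpha <> RtoC 0 -> Rlt (Cmod alpha) 1 -> algebraic alpha ->
  transcendental (Cexp (Copp (S alpha))).
Proof.
move=> p2 HS alpha0 alpha1 alg_alpha alg_T.
have p2' : (2 <= p)%coq_nat by apply/ssrnat.leP.
pose T (z : CC) : CC := toC (Cexp (Copp (S (ofC z)))).
have lt1 (z : CC) : abs z < 1 -> Rlt (Cmod (ofC z)) 1.
  by move=> /RltP; rewrite -{1}(ofCK z) abs_toC.
have T_cvg (z : CC) : abs z < 1 -> cvgs (fun m => ev (truncT p m) z) (T z).
  move=> /lt1 z1 e /RltP e0.
  have [m0 hm0] := exp_log_trunc_cvg p p2' _ _ z1 (HS _ z1) e e0.
  exists m0 => m le_m; rewrite -{1}(ofCK z) ev_truncT -toC_minus abs_toC.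
  by apply/RltP; apply: hm0; apply/ssrnat.leP.
have T_mahler (z : CC) : abs z < 1 -> T (z ^+ p) = (1 - z ^+ p) * T z ^+ p.
  move=> /[dup] /lt1 z1 z1'.
  have zp : ofC (z ^+ p) = Cpow (ofC z) p by rewrite -{1}(ofCK z) -toC_pow toCK.
  have zp1 : Rlt (Cmod (Cpow (ofC z) p)) 1.
    rewrite -zp; apply: lt1; rewrite absX exprn_ilt1 ?abs_ge0 //.
    by rewrite -lt0n; apply: leq_trans p2.
  rewrite /T zp (Tp_mahler p p2' _ _ _ z1 (HS _ z1) (HS _ zp1)).
  by rewrite toC_mult toC_minus !toC_pow ofCK toC_real.
have alg' := algebraic_toC alg_alpha.
have := algebraic_toC alg_T.
have eT : T (toC alpha) = toC (Cexp (Copp (S alpha))) by rewrite /T toCK.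
rewrite -eT; apply: (transcendence p2 T_cvg T_mahler) => //.
  apply/eqP => e0; apply: alpha0; rewrite -(toCK alpha) e0.
  by [].
by apply/RltP; rewrite abs_toC.
Qed.

End Mahler.

Theorem theorem1p1 (p : nat) (alpha : C) :
  prime (Z.of_nat p) ->
  alpha <> RtoC 0 ->
  Cmod alpha < 1 ->
  algebraic alpha ->
  exists S : C,
    @is_series C_AbsRing C_NormedModule (Tp_log_term p alpha) S /\
    transcendental (Cexp (Copp S)).
Proof.
intros Hp H0 H1 Halg.
assert (p2 : (2 <= p)%nat) by (apply prime_ge_2 in Hp; lia).
(* Placing the condition |z| < 1 under the existential makes the statement total, so choice yields a
   function; outside the disk its value is the arbitrary 0. *)
assert (sums : forall z, exists S : C, Cmod z < 1 ->
  @is_series C_AbsRing C_NormedModule (Tp_log_term p z) S).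
{ intros z; destruct (Rlt_dec (Cmod z) 1) as [Hz|Hz].
  - destruct (Tp_log_term_summable p p2 z Hz) as [S HS]; now exists S.
  - now exists (RtoC 0). }
destruct (boolp.choice sums) as [S HS].
exists (S alpha); split; [now apply HS|].
apply (@Mahler.Tp_transcendental p S alpha); try assumption.
now apply (ssrbool.introT ssrnat.leP).
Qed.
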